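(* Let $G,H:\mathbb{R}^2\to\mathbb{R}$ be $C^1$ functions. Consider the piecewise-defined planar vector field $F=(F_1,F_2)$ on $\mathbb{R}\times\mathbb{R}$ given by $$\dot x = G(x,y),\qquad \dot y=\begin{cases} -|H(x,y)| & \text{if } y>1,\\[2pt] \dfrac{H(x,y)-|H(x,y)|}{2} & \text{if } y=1,\\[4pt] H(x,y) & \text{if } 0<y<1,\\[2pt] \dfrac{H(x,y)+|H(x,y)|}{2} & \text{if } y=0,\\[4pt] |H(x,y)| & \text{if } y<0. \end{cases}$$ Then for every initial condition $(x(0),y(0))\in\mathbb{R}^2$ the initial value problem $\dot z=F(z)$ has a Filippov solution, and this Filippov solution is unique in forward time. Furthermore, the strip $\mathbb{R}\times[0,1]$ is forward invariant: any Filippov solution starting in $\mathbb{R}\times[0,1]$ remains in $\mathbb{R}\times[0,1]$ for all forward times for which it is defined.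
   Context: Filippov solutions: for a locally essentially bounded vector field $F:\mathbb{R}^2\to\mathbb{R}^2$, define the set-valued map $\mathcal{K}[F](z)=\bigcap_{\delta>0}\bigcap_{\mu(N)=0}\overline{\mathrm{co}}\,F(B_\delta(z)\setminus N)$, where $\mu$ is Lebesgue measure, $B_\delta(z)$ the open ball of radius $\delta$ about $z$, and $\overline{\mathrm{co}}$ the closed convex hull. A Filippov solution of $\dot z=F(z)$ on an interval $I$ is an absolutely continuous curve $z:I\to\mathbb{R}^2$ with $\dot z(t)\in\mathcal{K}[F](z(t))$ for almost every $t\in I$. ''Unique in forward time'' means any two Filippov solutions with the same initial value coincide on their common forward time interval. *)

(* Defs.v *)
From Stdlib Require Import Reals Lra List.
Open Scope R_scope.

Definition pt := (R * R)%type.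

Definition dist2 (p q : pt) : R :=
  sqrt ((fst p - fst q)^2 + (snd p - snd q)^2).

Definition cont2 (f : R -> R -> R) : Prop :=
  forall x y eps, 0 < eps -> exists del, 0 < del /\
    forall x' y', dist2 (x', y') (x, y) < del -> Rabs (f x' y' - f x y) < eps.

Definition C1_2 (f : R -> R -> R) : Prop :=
  exists fx fy : R -> R -> R,
    (forall x y, derivable_pt_lim (fun s => f s y) x (fx x y)) /\
    (forall x y, derivable_pt_lim (fun s => f x s) y (fy x y)) /\
    cont2 fx /\ cont2 fy.

Definition Fsys (G H : R -> R -> R) (z : pt) : pt :=
  let x := fst z in let y := snd z in
  let h := H x y in
  (G x y,
   if Rlt_dec 1 y then - Rabs h
   else if Rlt_dec 0 y then
          (if Req_EM_T y 1 then (h - Rabs h) / 2 else h)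
   else if Req_EM_T y 0 then (h + Rabs h) / 2
   else Rabs h).

Definition null2 (N : pt -> Prop) : Prop :=
  forall eps, 0 < eps -> exists a b c d : nat -> R,
    (forall n, a n <= b n /\ c n <= d n) /\
    (forall p, N p -> exists n, a n < fst p < b n /\ c n < snd p < d n) /\
    (forall n, sum_f_R0 (fun k => (b k - a k) * (d k - c k)) n <= eps).

Definition null1 (N : R -> Prop) : Prop :=
  forall eps, 0 < eps -> exists a b : nat -> R,
    (forall n, a n <= b n) /\
    (forall t, N t -> exists n, a n < t < b n) /\
    (forall n, sum_f_R0 (fun k => b k - a k) n <= eps).

Definition wsum (l : list (R * pt)) : pt :=
  fold_right (fun p acc => (fst p * fst (snd p) + fst acc,
                            fst p * snd (snd p) + snd acc)) (0, 0) l.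

Definition conv_hull (S : pt -> Prop) (v : pt) : Prop :=
  exists l : list (R * pt),
    Forall (fun p => 0 <= fst p /\ S (snd p)) l /\
    fold_right (fun p acc => fst p + acc) 0 l = 1 /\
    v = wsum l.

Definition closure (S : pt -> Prop) (v : pt) : Prop :=
  forall eps, 0 < eps -> exists u, S u /\ dist2 u v < eps.

Definition closed_conv_hull (S : pt -> Prop) : pt -> Prop :=
  closure (conv_hull S).

Definition filippov_K (F : pt -> pt) (z : pt) (v : pt) : Prop :=
  forall delta, 0 < delta -> forall N : pt -> Prop, null2 N ->
    closed_conv_hull
      (fun u => exists w, dist2 w z < delta /\ ~ N w /\ u = F w) v.

Fixpoint ordered_intervals (lo hi : R) (l : list (R * R)) : Prop :=
  match l with
  | nil => True
  | (a, b) :: l' => lo <= a /\ a <= b /\ b <= hi /\ ordered_intervals b hi l'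
  end.

Definition abs_cont1 (f : R -> R) (lo hi : R) : Prop :=
  forall eps, 0 < eps -> exists del, 0 < del /\
    forall l, ordered_intervals lo hi l ->
      fold_right (fun p acc => (snd p - fst p) + acc) 0 l < del ->
      fold_right (fun p acc => Rabs (f (snd p) - f (fst p)) + acc) 0 l < eps.

Definition abs_cont (z : R -> pt) (lo hi : R) : Prop :=
  abs_cont1 (fun t => fst (z t)) lo hi /\ abs_cont1 (fun t => snd (z t)) lo hi.

Definition filippov_sol (F : pt -> pt) (T : R) (z : R -> pt) : Prop :=
  0 < T /\ abs_cont z 0 T /\
  exists N : R -> Prop, null1 N /\
    forall t, 0 < t < T -> ~ N t ->
      exists v : pt,
        derivable_pt_lim (fun s => fst (z s)) t (fst v) /\
        derivable_pt_lim (fun s => snd (z s)) t (snd v) /\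
        filippov_K F (z t) v.

(* Main.v *)
From Stdlib Require Import ZArith Lra Lia List Classical ClassicalEpsilon Cantor.
From Coquelicot Require Import Coquelicot.
Require Import Defs.
From Stdlib Require Import Reals.
Open Scope R_scope.

(** For fixed [h], the second component of the field is a nonincreasing function
    of [y] (from [|h|] down to [-|h|]) and it is 1-Lipschitz in [h]; hence the
    field, and with it its Filippov hull, is locally one-sided Lipschitz, and a
    Gronwall argument on the squared distance of two solutions gives forward
    uniqueness. Invariance of the strip holds because the hull has vertical
    component <= 0 above it and >= 0 below it.

    For existence, a solution starting at the upper edge is obtained from a
    Skorokhod reflection at [y = 1]: with [w' = H(x, y)], put
    [y = w - sup_{s <= t} (w(s) - 1)^+]. The reflection map is Lipschitz in the
    sup norm, so Picard iteration applies. While [y = 1] one has [H >= 0], and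
    then [(G, 0)] is the midpoint of the two one-sided limits [(G, H)] and
    [(G, -|H|)]. Since [w] is C^1, [y] is differentiable except at the times
    when it arrives at the edge after an excursion below it, and there are only
    countably many of these. *)

(** * Null sets and absolutely continuous functions *)

(** Null sets enter only through countable covers, so the recurring difficulty is to pass from local
    or almost-everywhere information to a whole interval. [cousin], a compactness principle for
    additive interval predicates, does this: it shows that a rectangle is not null, that an
    almost-everywhere slope bound controls growth, and that a continuous function is bounded.

    Following a trajectory from edge to edge would not give existence: $H$ may change sign
    infinitely often along it, so contact and departure times can accumulate. Reflection treats all
    contacts at once, and its price is the set of corner times.

    The hull is used in two opposite ways. Bounds on all its vectors come from half-planes and may
    ignore null sets. Membership in it must survive the removal of an arbitrary null set, and
    therefore needs field values that persist on whole rectangles. *)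

Lemma cousin (P : R -> R -> Prop) (a b : R) :
  a <= b ->
  (forall u v w, a <= u <= v -> v <= w <= b -> P u v -> P v w -> P u w) ->
  (forall t, a <= t <= b -> exists del, 0 < del /\
     forall u v, a <= u <= t -> t <= v <= b -> v - u < del -> P u v) ->
  P a b.
Proof.
  intros Hab Hadd Hloc.
  pose (S := fun t => a <= t <= b /\ P a t).
  assert (HSa : S a).
  { split; [lra|]. destruct (Hloc a) as [d [Hd H]]; [lra|]. apply H; lra. }
  destruct (completeness S) as [m [Hub Hlub]].
  - exists b. intros t [Ht _]. lra.
  - exists a. exact HSa.
  - assert (Hm : a <= m <= b).
    { split; [apply Hub, HSa|]. apply Hlub. intros t [Ht _]. lra. }
    destruct (Hloc m Hm) as [d [Hd H]].
    assert (Hs : exists s, S s /\ m - d / 2 < s).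
    { apply NNPP. intros Hn.
      assert (m <= m - d / 2); [|lra].
      apply Hlub. intros t Ht. apply Rnot_lt_le. intros Hlt. apply Hn. exists t. split; assumption. }
    destruct Hs as [s [[Hs HPs] Hsm]].
    assert (s <= m) by (apply Hub; split; assumption).
    (* Since [m - d / 2 < s] and [q <= m + d / 4], the piece from [s] to [q] is shorter than [d]. It
       extends the chain past the supremum unless [q = b]. *)
    pose (q := Rmin b (m + d / 4)).
    assert (Hq : m <= q <= b /\ q <= m + d / 4 /\ (q < b -> m < q)).
    { unfold q, Rmin. destruct (Rle_dec b (m + d / 4)); lra. }
    assert (HPq : P a q).
    { apply (Hadd a s q); try lra; [assumption|]. apply H; lra. }
    destruct (Rlt_dec q b) as [Hqb|Hqb].
    + assert (q <= m); [|lra]. apply Hub. split; [lra|assumption].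
    + replace b with q by lra. exact HPq.
Qed.

(** Length of the intersection of two intervals. It is superadditive in the second interval, so a
    covering sum dominates the sums over adjacent pieces. *)
Definition overlap (a b u v : R) : R := Rmax 0 (Rmin b v - Rmax a u).

Ltac minmax := unfold Rmin, Rmax in *;
  repeat match goal with
  | |- context [Rle_dec ?x ?y] => destruct (Rle_dec x y)
  | H : context [Rle_dec ?x ?y] |- _ => destruct (Rle_dec x y)
  end.

Lemma overlap_ge0 a b u v : 0 <= overlap a b u v.
Proof. apply Rmax_l. Qed.

Lemma overlap_le a b u v : a <= b -> overlap a b u v <= b - a.
Proof. unfold overlap. intros. minmax; lra. Qed.

Lemma overlap_add a b u v w :
  u <= v -> v <= w -> overlap a b u v + overlap a b v w <= overlap a b u w.
Proof. unfold overlap. intros. minmax; lra. Qed.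

Lemma overlap_sub a b u v : a <= u -> u <= v -> v <= b -> overlap a b u v = v - u.
Proof. unfold overlap. intros. minmax; lra. Qed.

Lemma sum_f_R0_le_index (f : nat -> R) n m :
  (forall k, 0 <= f k) -> (n <= m)%nat -> sum_f_R0 f n <= sum_f_R0 f m.
Proof.
  intros Hf Hnm. induction Hnm as [|m Hnm IH]; [lra|].
  simpl. specialize (Hf (S m)). lra.
Qed.

Lemma sum_f_R0_ge_term (f : nat -> R) n :
  (forall k, 0 <= f k) -> f n <= sum_f_R0 f n.
Proof.
  intros Hf. destruct n as [|n]; simpl; [lra|].
  assert (0 <= sum_f_R0 f n) by (apply cond_pos_sum; assumption). lra.
Qed.

(* The finitely many rectangles of a null cover needed on a given rectangle have
   total overlap at least its area; this property is additive, so Cousin's lemma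
   is applied in each variable. *)
Lemma box_not_null (N : pt -> Prop) a b c d :
  null2 N -> a < b -> c < d ->
  exists w, a < fst w < b /\ c < snd w < d /\ ~ N w.
Proof.
  intros HN Hab Hcd. apply NNPP. intros Hno.
  assert (Hall : forall p, a < fst p < b -> c < snd p < d -> N p).
  { intros p H1 H2. apply NNPP. intros Hp. apply Hno. exists p. tauto. }
  (* Cousin's lemma also tags endpoints, while [N] is only known to contain the open box; the closed
     middle thirds lie inside it. *)
  pose (a' := (2 * a + b) / 3). pose (b' := (a + 2 * b) / 3).
  pose (c' := (2 * c + d) / 3). pose (d' := (c + 2 * d) / 3).
  assert (Ha : a < a' /\ a' < b' /\ b' < b) by (unfold a', b'; lra).
  assert (Hc : c < c' /\ c' < d' /\ d' < d) by (unfold c', d'; lra).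
  assert (Hpos : 0 < (b' - a') * (d' - c')) by (apply Rmult_lt_0_compat; lra).
  destruct (HN ((b' - a') * (d' - c') / 2)) as (ra & rb & rc & rd & Hord & Hcov & Hsum); [lra|].
  pose (T := fun u v s t k => overlap (ra k) (rb k) u v * overlap (rc k) (rd k) s t).
  assert (HT : forall u v s t k, 0 <= T u v s t k)
    by (intros; apply Rmult_le_pos; apply overlap_ge0).
  pose (Q := fun u v s t => exists n, (v - u) * (t - s) <= sum_f_R0 (T u v s t) n).
  assert (Hcomb : forall u v s t u1 v1 s1 t1 u2 v2 s2 t2,
    Q u1 v1 s1 t1 -> Q u2 v2 s2 t2 ->
    (v - u) * (t - s) = (v1 - u1) * (t1 - s1) + (v2 - u2) * (t2 - s2) ->
    (forall k, T u1 v1 s1 t1 k + T u2 v2 s2 t2 k <= T u v s t k) -> Q u v s t).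
  { intros u v s t u1 v1 s1 t1 u2 v2 s2 t2 [n1 H1] [n2 H2] He Hk.
    exists (Nat.max n1 n2). rewrite He.
    apply Rle_trans with (sum_f_R0 (fun k => T u1 v1 s1 t1 k + T u2 v2 s2 t2 k) (Nat.max n1 n2)).
    - rewrite sum_plus. apply Rplus_le_compat.
      + eapply Rle_trans; [exact H1|]. apply sum_f_R0_le_index; [apply HT|lia].
      + eapply Rle_trans; [exact H2|]. apply sum_f_R0_le_index; [apply HT|lia].
    - apply sum_Rle. intros; apply Hk. }
  assert (HQ : Q a' b' c' d').
  { apply (cousin (fun u v => Q u v c' d')); [lra| |].
    - intros u v w Hu Hv H1 H2. eapply Hcomb; [exact H1|exact H2|ring|].
      intros k. unfold T. rewrite <- Rmult_plus_distr_r. apply Rmult_le_compat_r; [apply overlap_ge0|].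
      apply overlap_add; lra.
    - intros x Hx.
      (* The predicate carries its own gauge in the first variable. Joining two pieces takes the
         minimum, so the whole column over [x] ends with one positive width. *)
      apply (cousin (fun s t => exists del, 0 < del /\
        forall u v, a' <= u <= x -> x <= v <= b' -> v - u < del -> Q u v s t)); [lra| |].
      + intros s t t' Hs Ht [d1 [Hd1 H1]] [d2 [Hd2 H2]].
        exists (Rmin d1 d2). split; [apply Rmin_glb_lt; assumption|].
        intros u v Hu Hv Hd.
        assert (v - u < d1 /\ v - u < d2) by (minmax; lra).
        eapply Hcomb; [apply (H1 u v); tauto|apply (H2 u v); tauto|ring|].
        intros k. unfold T. rewrite <- Rmult_plus_distr_l. apply Rmult_le_compat_l; [apply overlap_ge0|].
        apply overlap_add; lra.
      + intros y Hy. destruct (Hcov (x, y)) as [n Hn]; [apply Hall; simpl; lra|]. simpl in Hn.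
        pose (e1 := Rmin (x - ra n) (rb n - x)). pose (e2 := Rmin (y - rc n) (rd n - y)).
        assert (He1 : 0 < e1) by (apply Rmin_glb_lt; lra).
        assert (He2 : 0 < e2) by (apply Rmin_glb_lt; lra).
        exists e2. split; [assumption|]. intros s t Hs Ht Hd.
        exists e1. split; [assumption|]. intros u v Hu Hv Hd'.
        assert (ra n <= u /\ v <= rb n) by (unfold e1 in Hd'; minmax; lra).
        assert (rc n <= s /\ t <= rd n) by (unfold e2 in Hd; minmax; lra).
        exists n. apply Rle_trans with (T u v s t n); [|apply sum_f_R0_ge_term, HT].
        unfold T. rewrite !overlap_sub by lra. lra. }
  destruct HQ as [n Hn].
  assert (sum_f_R0 (T a' b' c' d') n <= (b' - a') * (d' - c') / 2); [|lra].
  eapply Rle_trans; [|apply (Hsum n)]. apply sum_Rle. intros k _. specialize (Hord k). unfold T.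
  apply Rmult_le_compat; try apply overlap_ge0; apply overlap_le; lra.
Qed.

Lemma null1_add (N : R -> Prop) (p : R) : null1 N -> null1 (fun t => N t \/ t = p).
Proof.
  intros HN eps Heps. destruct (HN (eps / 2)) as (a & b & Hab & Hcov & Hsum); [lra|].
  exists (fun n => match n with O => p - eps / 4 | S m => a m end).
  exists (fun n => match n with O => p + eps / 4 | S m => b m end).
  split; [|split].
  - intros [|n]; [lra|apply Hab].
  - intros t [Ht| ->]; [|exists O; lra]. destruct (Hcov t Ht) as [n Hn]. exists (S n). exact Hn.
  - intros [|n]; [simpl; lra|].
    rewrite decomp_sum by lia. simpl. specialize (Hsum n). simpl in Hsum. lra.
Qed.

Lemma null1_union (N1 N2 : R -> Prop) : null1 N1 -> null1 N2 -> null1 (fun t => N1 t \/ N2 t).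
Proof.
  intros H1 H2 eps Heps.
  destruct (H1 (eps / 2)) as (a1 & b1 & Hab1 & Hcov1 & Hsum1); [lra|].
  destruct (H2 (eps / 2)) as (a2 & b2 & Hab2 & Hcov2 & Hsum2); [lra|].
  pose (mix := fun (f g : nat -> R) n => if Nat.even n then f (Nat.div2 n) else g (Nat.div2 n)).
  assert (Hev : forall f g n, mix f g (2 * n)%nat = f n).
  { intros f g n. unfold mix. rewrite Nat.even_even, Nat.div2_double. reflexivity. }
  assert (Hod : forall f g n, mix f g (S (2 * n)) = g n).
  { intros f g n. unfold mix. rewrite Nat.even_succ, Nat.odd_even, Nat.div2_succ_double. reflexivity. }
  exists (mix a1 a2), (mix b1 b2). split; [|split].
  - intros n. unfold mix. destruct (Nat.even n); auto.
  - intros t [Ht|Ht].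
    + destruct (Hcov1 t Ht) as [n Hn]. exists (2 * n)%nat. rewrite !Hev. exact Hn.
    + destruct (Hcov2 t Ht) as [n Hn]. exists (S (2 * n)). rewrite !Hod. exact Hn.
  - intros n. eapply Rle_trans; [apply sum_f_R0_le_index with (m := S (2 * n)); [|lia]|].
    + intros k. unfold mix. destruct (Nat.even k); [specialize (Hab1 (Nat.div2 k))|specialize (Hab2 (Nat.div2 k))]; lra.
    + assert (E : forall m, sum_f_R0 (fun k => mix b1 b2 k - mix a1 a2 k) (S (2 * m))
        = sum_f_R0 (fun k => b1 k - a1 k) m + sum_f_R0 (fun k => b2 k - a2 k) m).
      { induction m as [|m IH]; [unfold mix; simpl; ring|].
        replace (S (2 * S m)) with (S (S (S (2 * m)))) by lia.
        rewrite tech5, tech5, IH.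
        replace (S (S (S (2 * m)))) with (S (2 * S m)) by lia.
        replace (S (S (2 * m))) with (2 * S m)%nat by lia.
        rewrite !Hev, !Hod. cbn [sum_f_R0]. ring. }
      rewrite E. specialize (Hsum1 n). specialize (Hsum2 n). lra.
Qed.

(** * Growth of absolutely continuous functions *)

Definition total_length (l : list (R * R)) : R :=
  fold_right (fun p acc => (snd p - fst p) + acc) 0 l.

Definition variation (f : R -> R) (l : list (R * R)) : R :=
  fold_right (fun p acc => Rabs (f (snd p) - f (fst p)) + acc) 0 l.

Lemma total_length_app l l' : total_length (l ++ l') = total_length l + total_length l'.
Proof. unfold total_length. induction l as [|p l IH]; simpl; [ring|]. rewrite IH. ring. Qed.

Lemma variation_app f l l' : variation f (l ++ l') = variation f l + variation f l'.
Proof. unfold variation. induction l as [|p l IH]; simpl; [ring|]. rewrite IH. ring. Qed.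

Lemma ordered_intervals_widen lo hi lo' hi' l :
  lo' <= lo -> hi <= hi' -> ordered_intervals lo hi l -> ordered_intervals lo' hi' l.
Proof.
  revert lo lo'. induction l as [|[a b] l IH]; simpl; [tauto|].
  intros lo lo' H1 H2 (Ha & Hab & Hb & Hl). repeat split; try lra. apply IH with b; auto; lra.
Qed.

Lemma ordered_intervals_app u v w l l' :
  u <= v -> v <= w ->
  ordered_intervals u v l -> ordered_intervals v w l' -> ordered_intervals u w (l ++ l').
Proof.
  intros Huv Hvw. revert u Huv. induction l as [|[a b] l IH]; simpl; intros u Huv.
  - intros _. apply ordered_intervals_widen; lra.
  - intros (Ha & Hab & Hb & Hl) Hl'. repeat split; try lra. apply IH; auto; lra.
Qed.

Lemma abs_cont1_sub f lo hi lo' hi' :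
  lo <= lo' -> hi' <= hi -> abs_cont1 f lo hi -> abs_cont1 f lo' hi'.
Proof.
  intros H1 H2 Hf eps Heps. destruct (Hf eps Heps) as [d [Hd H]]. exists d. split; [assumption|].
  intros l Hl. apply H. apply ordered_intervals_widen with lo' hi'; assumption.
Qed.

Lemma abs_cont1_continuous f lo hi eps :
  abs_cont1 f lo hi -> 0 < eps -> exists del, 0 < del /\
    forall s t, lo <= s <= hi -> lo <= t <= hi -> Rabs (s - t) < del -> Rabs (f s - f t) < eps.
Proof.
  intros Hf Heps. destruct (Hf eps Heps) as [d [Hd H]]. exists d. split; [assumption|].
  assert (Hw : forall s t, lo <= s <= hi -> lo <= t <= hi -> s <= t -> Rabs (s - t) < d ->
    Rabs (f t - f s) < eps).
  { intros s t Hs Ht Hle Hd'. specialize (H ((s, t) :: nil)). simpl in H.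
    rewrite !Rplus_0_r in H. apply H; [lra|]. unfold Rabs in Hd'. destruct (Rcase_abs (s - t)); lra. }
  intros s t Hs Ht Hst. destruct (Rle_dec s t).
  - rewrite Rabs_minus_sym. apply Hw; auto.
  - apply Hw; auto; [lra|]. rewrite Rabs_minus_sym. assumption.
Qed.

(* Along a fine partition, tags outside the null set contribute at most
   (C + eps) * length, and the remaining intervals lie in a cover of small total
   length, so absolute continuity bounds their contribution. *)
Lemma abs_cont1_growth f lo hi C (N : R -> Prop) :
  lo <= hi -> 0 <= C -> abs_cont1 f lo hi -> null1 N ->
  (forall t, lo < t < hi -> ~ N t -> exists d, derivable_pt_lim f t d /\ d <= C) ->
  f hi - f lo <= C * (hi - lo).
Proof.
  intros Hle HC Hac HN0 Hder.
  (* The derivative is only given inside the interval, so both endpoints are treated as exceptional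
     tags. *)
  assert (HN := null1_add _ hi (null1_add _ lo HN0)).
  apply le_epsilon. intros e0 He0.
  pose (eps := e0 / (2 * (hi - lo + 1))).
  assert (Heps : 0 < eps) by (apply Rdiv_lt_0_compat; lra).
  assert (Hee : eps * (hi - lo) <= e0 / 2).
  { apply Rle_trans with (eps * (hi - lo + 1)); [apply Rmult_le_compat_l; lra|].
    unfold eps. right. field. lra. }
  destruct (Hac (e0 / 2)) as [del [Hdel Hvar]]; [lra|].
  destruct (HN (del / 2)) as (a & b & Hab & Hcov & Hsum); [lra|].
  pose (ov := fun u v k => overlap (a k) (b k) u v).
  assert (Hov : forall u v k, 0 <= ov u v k) by (intros; apply overlap_ge0).
  assert (HP : exists l n, ordered_intervals lo hi l /\
     total_length l <= sum_f_R0 (ov lo hi) n /\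
     f hi - f lo <= (C + eps) * (hi - lo) + variation f l).
  { apply (cousin (fun u v => exists l n, ordered_intervals u v l /\
     total_length l <= sum_f_R0 (ov u v) n /\
     f v - f u <= (C + eps) * (v - u) + variation f l)); [assumption| |].
    - intros u v w Hu Hv (l1 & n1 & Ho1 & Hl1 & Hf1) (l2 & n2 & Ho2 & Hl2 & Hf2).
      exists (l1 ++ l2), (Nat.max n1 n2). split; [|split].
      + apply ordered_intervals_app with v; auto; lra.
      + rewrite total_length_app.
        apply Rle_trans with (sum_f_R0 (fun k => ov u v k + ov v w k) (Nat.max n1 n2)).
        * rewrite sum_plus. apply Rplus_le_compat.
          -- eapply Rle_trans; [exact Hl1|]. apply sum_f_R0_le_index; [apply Hov|lia].
          -- eapply Rle_trans; [exact Hl2|]. apply sum_f_R0_le_index; [apply Hov|lia].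
        * apply sum_Rle. intros k _. apply overlap_add; lra.
      + rewrite variation_app. lra.
    - intros t Ht. destruct (classic ((N t \/ t = lo) \/ t = hi)) as [Hin|Hout].
      + destruct (Hcov t Hin) as [n Hn].
        exists (Rmin (t - a n) (b n - t)). split; [apply Rmin_glb_lt; lra|].
        intros u v Hu Hv Hd.
        assert (a n <= u /\ v <= b n) by (minmax; lra).
        exists ((u, v) :: nil), n. split; [simpl; lra|]. split.
        * apply Rle_trans with (ov u v n); [|apply sum_f_R0_ge_term, Hov].
          unfold ov. rewrite overlap_sub by lra. unfold total_length; simpl; lra.
        (* Because [C >= 0], an exceptional piece also fits the slope budget; its actual increment
           is charged to the variation over the list. *)
        * assert (f v - f u <= Rabs (f v - f u)) by apply Rle_abs.
          assert (0 <= (C + eps) * (v - u)) by (apply Rmult_le_pos; lra).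
          unfold variation; simpl; lra.
      + destruct (Hder t) as [d [Hd HdC]]; [|tauto|].
        { assert (t <> lo /\ t <> hi) by tauto. lra. }
        destruct (Hd eps Heps) as [del' Hdel'].
        assert (Hdel'0 := cond_pos del').
        exists del'. split; [assumption|]. intros u v Hu Hv Hduv.
        assert (Hone : forall h, h <> 0 -> Rabs h < del' ->
          Rabs (f (t + h) - f t - d * h) <= eps * Rabs h).
        { intros h Hh Hhd. specialize (Hdel' h Hh Hhd).
          replace (f (t + h) - f t - d * h) with (((f (t + h) - f t) / h - d) * h) by (field; assumption).
          rewrite Rabs_mult. apply Rmult_le_compat_r; [apply Rabs_pos|lra]. }
        assert (Hr : f v - f t <= (C + eps) * (v - t)).
        { destruct (Req_EM_T v t) as [->|Hne]; [lra|].
          assert (H := Hone (v - t) ltac:(lra)). rewrite Rabs_right in H by lra.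
          specialize (H ltac:(lra)). replace (t + (v - t)) with v in H by ring.
          apply Rabs_le_between in H. assert (d * (v - t) <= C * (v - t)) by (apply Rmult_le_compat_r; lra). lra. }
        assert (Hl : f t - f u <= (C + eps) * (t - u)).
        { destruct (Req_EM_T u t) as [->|Hne]; [lra|].
          assert (H := Hone (u - t) ltac:(lra)). rewrite Rabs_left in H by lra.
          specialize (H ltac:(lra)). replace (t + (u - t)) with u in H by ring.
          apply Rabs_le_between in H. assert (d * (t - u) <= C * (t - u)) by (apply Rmult_le_compat_r; lra). lra. }
        exists nil, O. split; [exact I|]. split.
        * unfold total_length. simpl. apply Hov.
        * unfold variation. simpl. lra. }
  destruct HP as (l & n & Hl & Hlen & Hf).
  assert (Hlen' : total_length l < del).
  { apply Rle_lt_trans with (del / 2); [|lra]. eapply Rle_trans; [exact Hlen|].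
    eapply Rle_trans; [|apply (Hsum n)]. apply sum_Rle. intros k _. apply overlap_le, Hab. }
  specialize (Hvar l Hl Hlen'). fold (variation f l) in Hvar. lra.
Qed.

Lemma variation_le (f f1 f2 : R -> R) c lo hi l :
  0 <= c ->
  (forall s t, lo <= s <= hi -> lo <= t <= hi ->
     Rabs (f t - f s) <= c * (Rabs (f1 t - f1 s) + Rabs (f2 t - f2 s))) ->
  ordered_intervals lo hi l ->
  variation f l <= c * (variation f1 l + variation f2 l).
Proof.
  intros Hc. revert lo. unfold variation. induction l as [|[a b] l IH]; simpl; intros lo H Hl; [lra|].
  destruct Hl as (Ha & Hab & Hb & Hl).
  assert (IH' := IH b ltac:(intros; apply H; lra) Hl).
  assert (Hw := H a b ltac:(lra) ltac:(lra)). lra.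
Qed.

(** A single comparison principle from which negations, absolute gaps, their sums and squares, and
    Lipschitz functions all inherit absolute continuity. *)
Lemma abs_cont1_dominated f f1 f2 c lo hi :
  0 < c ->
  (forall s t, lo <= s <= hi -> lo <= t <= hi ->
     Rabs (f t - f s) <= c * (Rabs (f1 t - f1 s) + Rabs (f2 t - f2 s))) ->
  abs_cont1 f1 lo hi -> abs_cont1 f2 lo hi -> abs_cont1 f lo hi.
Proof.
  intros Hc H H1 H2 eps Heps.
  destruct (H1 (eps / (2 * c))) as [d1 [Hd1 HH1]]; [apply Rdiv_lt_0_compat; lra|].
  destruct (H2 (eps / (2 * c))) as [d2 [Hd2 HH2]]; [apply Rdiv_lt_0_compat; lra|].
  exists (Rmin d1 d2). split; [apply Rmin_glb_lt; assumption|].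
  intros l Hl Hlen.
  assert (Hlen' : total_length l < d1 /\ total_length l < d2) by (fold (total_length l) in Hlen; minmax; lra).
  specialize (HH1 l Hl (proj1 Hlen')). specialize (HH2 l Hl (proj2 Hlen')).
  fold (variation f1 l) in HH1. fold (variation f2 l) in HH2. fold (variation f l).
  apply Rle_lt_trans with (c * (variation f1 l + variation f2 l)).
  - apply variation_le with lo hi; auto. lra.
  - apply Rlt_le_trans with (c * (eps / (2 * c) + eps / (2 * c))); [|right; field; lra].
    apply Rmult_lt_compat_l; lra.
Qed.

Lemma lipschitz_abs_cont1 f C lo hi :
  0 < C -> (forall s t, Rabs (f s - f t) <= C * Rabs (s - t)) -> abs_cont1 f lo hi.
Proof.
  intros HC Hf.
  assert (Hid : abs_cont1 (fun t => t) lo hi).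
  { intros eps Heps. exists eps. split; [assumption|]. intros l Hl Hlen.
    eapply Rle_lt_trans; [|exact Hlen]. clear Hlen. revert lo Hl.
    induction l as [|[a b] l IH]; simpl; intros lo Hl; [lra|].
    destruct Hl as (? & ? & ? & Hl). specialize (IH b Hl). rewrite Rabs_right; lra. }
  apply abs_cont1_dominated with (fun t => t) (fun t => t) C; auto.
  intros s t _ _. eapply Rle_trans; [apply Hf|]. apply Rmult_le_compat_l; [lra|].
  assert (0 <= Rabs (t - s)) by apply Rabs_pos. lra.
Qed.

(** By continuity the supremum of the times with [f s <= c] is itself such a time. This reduces
    invariance and uniqueness to an interval where the strict inequality holds throughout. *)
Lemma last_below f lo t c :
  abs_cont1 f lo t -> lo <= t -> f lo <= c -> c < f t ->
  exists s, lo <= s < t /\ f s <= c /\ forall r, s < r <= t -> c < f r.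
Proof.
  intros Hf Hle Hlo Ht.
  pose (S := fun s => lo <= s <= t /\ f s <= c).
  destruct (completeness S) as [m [Hub Hlub]].
  - exists t. intros s [Hs _]. lra.
  - exists lo. split; lra.
  - assert (Hm : lo <= m <= t).
    { split; [apply Hub; split; lra|]. apply Hlub. intros s [Hs _]. lra. }
    assert (Hfm : f m <= c).
    { apply Rnot_lt_le. intros Hlt.
      destruct (abs_cont1_continuous f lo t (f m - c) Hf) as [d [Hd H]]; [lra|].
      assert (m <= m - d / 2); [|lra].
      apply Hlub. intros s [Hs Hfs]. apply Rnot_lt_le. intros Hsm.
      assert (s <= m) by (apply Hub; split; assumption).
      specialize (H m s Hm Hs). rewrite Rabs_right in H by lra.
      specialize (H ltac:(lra)). apply Rabs_def2 in H. lra. }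
    exists m. split; [|split; [assumption|]].
    + split; [lra|]. destruct (Req_EM_T m t) as [->|]; lra.
    + intros r Hr. apply Rnot_le_lt. intros Hle'. assert (r <= m); [|lra].
      apply Hub. split; [lra|assumption].
Qed.

(** After the last time at level at most [c] the slope is nonpositive almost everywhere, so
    [abs_cont1_growth] with constant 0 forbids any rise. *)
Lemma stays_below f T c N :
  abs_cont1 f 0 T -> null1 N -> f 0 <= c ->
  (forall t, 0 < t < T -> ~ N t -> c < f t -> exists d, derivable_pt_lim f t d /\ d <= 0) ->
  forall t, 0 <= t <= T -> f t <= c.
Proof.
  intros Hf HN H0 Hd t Ht. apply Rnot_lt_le. intros Hlt.
  destruct (last_below f 0 t c) as (s & Hs & Hfs & Habove); auto; try lra.
  { apply abs_cont1_sub with 0 T; auto; lra. }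
  assert (f t - f s <= 0 * (t - s)); [|lra].
  apply abs_cont1_growth with N; auto; try lra.
  - apply abs_cont1_sub with 0 T; auto; lra.
  - intros r Hr HNr. apply Hd; auto; [lra|]. apply Habove. lra.
Qed.

Lemma le_halving a b K : 0 <= K -> (forall n, a <= b + K / 2 ^ n) -> a <= b.
Proof.
  intros HK H. apply le_epsilon. intros eps Heps.
  destruct (pow_lt_1_zero (/ 2)) with (y := eps / (K + 1)) as [n Hn].
  - rewrite Rabs_right; lra.
  - apply Rdiv_lt_0_compat; lra.
  - specialize (Hn n (le_n n)). rewrite Rabs_right in Hn by (apply Rle_ge, pow_le; lra).
    eapply Rle_trans; [apply (H n)|]. apply Rplus_le_compat_l. unfold Rdiv. rewrite <- pow_inv.
    assert (0 <= (/ 2) ^ n) by (apply pow_le; lra).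
    apply Rle_trans with ((K + 1) * (/ 2) ^ n); [apply Rmult_le_compat_r; lra|].
    apply Rle_trans with ((K + 1) * (eps / (K + 1))); [apply Rmult_le_compat_l; lra|right; field; lra].
Qed.

(** Halving takes the place of an exponential: a bound [B] on [f] gives slope at most [K * B], hence
    the bound [B / 2] on this short interval, and iteration drives the bound to 0. *)
Lemma gronwall_zero f s q K N :
  s <= q -> 0 < K -> K * (q - s) <= / 2 -> abs_cont1 f s q -> null1 N -> f s <= 0 ->
  (forall t, s <= t <= q -> 0 <= f t) ->
  (forall t, s < t < q -> ~ N t -> exists d, derivable_pt_lim f t d /\ d <= K * f t) ->
  f q <= 0.
Proof.
  intros Hsq HK Hsmall Hf HN Hs Hpos Hd.
  assert (Hhalf : forall B, 0 <= B -> (forall t, s <= t <= q -> f t <= B) ->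
     forall t, s <= t <= q -> f t <= B / 2).
  { intros B HB Hb t Ht.
    assert (Hg : f t - f s <= K * B * (t - s)).
    { apply abs_cont1_growth with N; auto; try lra.
      - apply Rmult_le_pos; lra.
      - apply abs_cont1_sub with s q; auto; lra.
      - intros r Hr HNr. destruct (Hd r) as [d [Hd1 Hd2]]; auto; [lra|]. exists d. split; auto.
        apply Rle_trans with (K * f r); auto. apply Rmult_le_compat_l; [lra|]. apply Hb. lra. }
    assert (K * (t - s) <= K * (q - s)) by (apply Rmult_le_compat_l; lra).
    assert (B * (K * (t - s)) <= B * / 2) by (apply Rmult_le_compat_l; lra).
    lra. }
  assert (Hb0 : exists B, 0 <= B /\ forall t, s <= t <= q -> f t <= B).
  (* The iteration needs some finite bound to start from. Boundedness is additive over adjacent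
     intervals and holds locally by continuity. *)
  { apply (cousin (fun u v => exists B, 0 <= B /\ forall t, u <= t <= v -> f t <= B)); [assumption| |].
    - intros u v w Hu Hv [B1 [HB1 H1]] [B2 [HB2 H2]]. exists (B1 + B2). split; [lra|].
      intros t Ht. destruct (Rle_dec t v); [specialize (H1 t)|specialize (H2 t)]; lra.
    - intros t Ht. destruct (abs_cont1_continuous f s q 1 Hf) as [d [Hd' H]]; [lra|].
      exists d. split; [assumption|]. intros u v Hu Hv Huv. exists (f t + 1).
      assert (Hft := Hpos t Ht). split; [lra|].
      intros r Hr. specialize (H r t ltac:(lra) Ht).
      assert (Rabs (r - t) < d) by (apply Rabs_def1; lra).
      specialize (H ltac:(assumption)). apply Rabs_def2 in H. lra. }
  destruct Hb0 as [B [HB Hb]].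
  assert (Hn : forall n t, s <= t <= q -> f t <= B / 2 ^ n).
  { induction n as [|n IH]; intros t Ht; [simpl; specialize (Hb t Ht); lra|].
    assert (0 < 2 ^ n) by (apply pow_lt; lra).
    replace (B / 2 ^ S n) with (B / 2 ^ n / 2) by (simpl; field; lra).
    apply Hhalf; auto. apply Rdiv_le_0_compat; lra. }
  apply le_halving with B; [assumption|]. intros n. rewrite Rplus_0_l. apply Hn. lra.
Qed.

(** * Filippov hulls, uniqueness and invariance *)

Lemma dist2_coord p q d : dist2 p q < d -> Rabs (fst p - fst q) < d /\ Rabs (snd p - snd q) < d.
Proof.
  intros H. unfold dist2 in H.
  split; (eapply Rle_lt_trans; [|exact H]); rewrite <- sqrt_Rsqr_abs; apply sqrt_le_1_alt; unfold Rsqr.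
  - assert (0 <= (snd p - snd q) ^ 2) by apply pow2_ge_0. lra.
  - assert (0 <= (fst p - fst q) ^ 2) by apply pow2_ge_0. lra.
Qed.

Lemma dist2_le p q : dist2 p q <= Rabs (fst p - fst q) + Rabs (snd p - snd q).
Proof.
  unfold dist2. assert (H1 := Rabs_pos (fst p - fst q)). assert (H2 := Rabs_pos (snd p - snd q)).
  rewrite <- (sqrt_Rsqr (Rabs _ + Rabs _)) by lra. apply sqrt_le_1_alt.
  rewrite <- (pow2_abs (fst p - fst q)), <- (pow2_abs (snd p - snd q)). unfold Rsqr.
  assert (0 <= Rabs (fst p - fst q) * Rabs (snd p - snd q)) by (apply Rmult_le_pos; lra). nra.
Qed.

Lemma conv_hull_halfplane S v a b C :
  conv_hull S v -> (forall u, S u -> a * fst u + b * snd u <= C) -> a * fst v + b * snd v <= C.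
Proof.
  intros (l & Hl & Hsum & ->) HS.
  apply Rle_trans with (C * fold_right (fun p acc => fst p + acc) 0 l); [|rewrite Hsum; lra].
  clear Hsum. induction Hl as [|[w p] l [Hw Hp] Hl IH]; simpl; [lra|].
  simpl in Hw, Hp. specialize (HS p Hp).
  assert (w * (a * fst p + b * snd p) <= w * C) by (apply Rmult_le_compat_l; lra).
  unfold wsum in IH |- *. simpl. lra.
Qed.

Lemma closed_conv_hull_halfplane S v a b C :
  closed_conv_hull S v -> (forall u, S u -> a * fst u + b * snd u <= C) ->
  a * fst v + b * snd v <= C.
Proof.
  intros Hv HS. apply le_epsilon. intros eps Heps.
  assert (Ha := Rabs_pos a). assert (Hb := Rabs_pos b).
  pose (k := Rabs a + Rabs b + 1).
  destruct (Hv (eps / k)) as [u [Hu Hd]]; [apply Rdiv_lt_0_compat; unfold k; lra|].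
  assert (Hu' := conv_hull_halfplane _ _ _ _ _ Hu HS).
  apply dist2_coord in Hd. destruct Hd as [H1 H2].
  assert (E1 : Rabs (a * (fst u - fst v)) <= Rabs a * (eps / k))
    by (rewrite Rabs_mult; apply Rmult_le_compat_l; lra).
  assert (E2 : Rabs (b * (snd u - snd v)) <= Rabs b * (eps / k))
    by (rewrite Rabs_mult; apply Rmult_le_compat_l; lra).
  assert (E3 : (Rabs a + Rabs b) * (eps / k) <= eps).
  { apply Rle_trans with (k * (eps / k)); [|right; unfold k; field; lra].
    apply Rmult_le_compat_r; [left; apply Rdiv_lt_0_compat; unfold k; lra|unfold k; lra]. }
  apply Rabs_le_between in E1. apply Rabs_le_between in E2. lra.
Qed.

(** A closed half-plane containing all field values on one ball contains their closed convex hull;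
    the removed null set is instantiated with the empty set. *)
Lemma filippov_K_halfplane F z v a b C delta :
  filippov_K F z v -> 0 < delta ->
  (forall w, dist2 w z < delta -> a * fst (F w) + b * snd (F w) <= C) ->
  a * fst v + b * snd v <= C.
Proof.
  intros HK Hdel H. apply (closed_conv_hull_halfplane _ _ _ _ _ (HK delta Hdel (fun _ => False) ltac:(
    intros eps Heps; exists (fun _ => 0), (fun _ => 0), (fun _ => 0), (fun _ => 0);
    split; [intros; lra|split; [tauto|intros n; rewrite sum_cte; lra]]))).
  intros u (w & Hw & _ & ->). apply H, Hw.
Qed.

(** The inequality is affine in each field value separately. For fixed [w2] the half-plane bound at
    [z1] replaces [F w1] by [v1]; the bound at [z2] then replaces [F w2] by [v2]. *)
Lemma filippov_K_pair F z1 z2 v1 v2 a b C :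
  filippov_K F z1 v1 -> filippov_K F z2 v2 ->
  (forall eps, 0 < eps -> exists delta, 0 < delta /\ forall w1 w2,
     dist2 w1 z1 < delta -> dist2 w2 z2 < delta ->
     a * (fst (F w1) - fst (F w2)) + b * (snd (F w1) - snd (F w2)) <= C + eps) ->
  a * (fst v1 - fst v2) + b * (snd v1 - snd v2) <= C.
Proof.
  intros H1 H2 H. apply le_epsilon. intros eps Heps.
  destruct (H eps Heps) as [d [Hd Hw]].
  assert (- a * fst v2 + - b * snd v2 <= C + eps - (a * fst v1 + b * snd v1)); [|lra].
  apply (filippov_K_halfplane F z2 v2 _ _ _ d); auto. intros w2 Hw2.
  assert (a * fst v1 + b * snd v1 <= C + eps + (a * fst (F w2) + b * snd (F w2))); [|lra].
  apply (filippov_K_halfplane F z1 v1 _ _ _ d); auto. intros w1 Hw1.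
  specialize (Hw w1 w2 Hw1 Hw2). lra.
Qed.

(** * Local Lipschitz bounds for $C^1$ functions *)

Definition lipschitz_box (f : R -> R -> R) x0 y0 r L :=
  forall x y x' y', Rabs (x - x0) <= r -> Rabs (y - y0) <= r ->
    Rabs (x' - x0) <= r -> Rabs (y' - y0) <= r ->
    Rabs (f x y - f x' y') <= L * (Rabs (x - x') + Rabs (y - y')).

Lemma mean_value_bound f f' a b c r L :
  (forall t, derivable_pt_lim f t (f' t)) ->
  (forall t, Rabs (t - c) <= r -> Rabs (f' t) <= L) ->
  Rabs (a - c) <= r -> Rabs (b - c) <= r -> Rabs (f a - f b) <= L * Rabs (a - b).
Proof.
  intros Hd HL.
  assert (Hlt : forall u v, u < v -> Rabs (u - c) <= r -> Rabs (v - c) <= r ->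
    Rabs (f v - f u) <= L * Rabs (v - u)).
  { intros u v Huv Hu Hv. destruct (MVT_cor2 f f' u v Huv) as [t [Ht1 Ht2]]; [intros; apply Hd|].
    rewrite Ht1, Rabs_mult. apply Rmult_le_compat_r; [apply Rabs_pos|]. apply HL.
    apply Rabs_le_between in Hu. apply Rabs_le_between in Hv. apply Rabs_le_between. lra. }
  intros Ha Hb. destruct (Rtotal_order a b) as [H|[->|H]].
  - rewrite Rabs_minus_sym, (Rabs_minus_sym a). apply Hlt; auto.
  - rewrite !Rminus_diag, Rabs_R0. lra.
  - apply Hlt; auto.
Qed.

Lemma C1_lipschitz_box f x0 y0 :
  C1_2 f -> exists r L, 0 < r /\ 0 < L /\ lipschitz_box f x0 y0 r L.
Proof.
  intros (fx & fy & Hfx & Hfy & Cx & Cy).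
  destruct (Cx x0 y0 1) as [d1 [Hd1 H1]]; [lra|].
  destruct (Cy x0 y0 1) as [d2 [Hd2 H2]]; [lra|].
  (* A point of the square of half-side [r] is at distance at most [2 * r] from the centre, hence
     within both continuity radii. The [+ 1] in [L] below is the tolerance used there. *)
  pose (r := Rmin d1 d2 / 3). assert (Hr : 0 < r /\ 2 * r < d1 /\ 2 * r < d2).
  { assert (0 < Rmin d1 d2) by (apply Rmin_glb_lt; assumption). unfold r. minmax; lra. }
  pose (L := Rabs (fx x0 y0) + Rabs (fy x0 y0) + 1).
  assert (P1 := Rabs_pos (fx x0 y0)). assert (P2 := Rabs_pos (fy x0 y0)).
  assert (Hbd : forall x y, Rabs (x - x0) <= r -> Rabs (y - y0) <= r ->
     Rabs (fx x y) <= L /\ Rabs (fy x y) <= L).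
  { intros x y Hx Hy. assert (Hd : dist2 (x, y) (x0, y0) <= 2 * r).
    { eapply Rle_trans; [apply dist2_le|]. simpl. lra. }
    specialize (H1 x y ltac:(lra)). specialize (H2 x y ltac:(lra)).
    assert (T1 := Rabs_triang_inv (fx x y) (fx x0 y0)).
    assert (T2 := Rabs_triang_inv (fy x y) (fy x0 y0)). unfold L. lra. }
  exists r, L. split; [lra|]. split; [unfold L; lra|].
  intros x y x' y' Hx Hy Hx' Hy'.
  assert (E1 : Rabs (f x y - f x' y) <= L * Rabs (x - x')).
  { apply (mean_value_bound (fun s => f s y) (fun s => fx s y) x x' x0 r); auto.
    intros t Ht. apply Hbd; assumption. }
  assert (E2 : Rabs (f x' y - f x' y') <= L * Rabs (y - y')).
  { apply (mean_value_bound (fun s => f x' s) (fun s => fy x' s) y y' y0 r); auto.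
    intros t Ht. apply Hbd; assumption. }
  replace (f x y - f x' y') with ((f x y - f x' y) + (f x' y - f x' y')) by ring.
  eapply Rle_trans; [apply Rabs_triang|]. lra.
Qed.

Lemma lipschitz_box_le f x y r L r' L' :
  r' <= r -> L <= L' -> lipschitz_box f x y r L -> lipschitz_box f x y r' L'.
Proof.
  intros Hr HL Hf a b a' b' H1 H2 H3 H4. eapply Rle_trans; [apply Hf; lra|].
  apply Rmult_le_compat_r; [|lra].
  assert (0 <= Rabs (a - a')) by apply Rabs_pos. assert (0 <= Rabs (b - b')) by apply Rabs_pos. lra.
Qed.

Lemma C1_lipschitz_box2 f g x y :
  C1_2 f -> C1_2 g ->
  exists r L, 0 < r /\ 0 < L /\ lipschitz_box f x y r L /\ lipschitz_box g x y r L.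
Proof.
  intros Hf Hg.
  destruct (C1_lipschitz_box f x y Hf) as (r1 & L1 & Hr1 & HL1 & Hf').
  destruct (C1_lipschitz_box g x y Hg) as (r2 & L2 & Hr2 & HL2 & Hg').
  exists (Rmin r1 r2), (L1 + L2). split; [apply Rmin_glb_lt; assumption|]. split; [lra|]. split.
  - apply lipschitz_box_le with r1 L1; auto; [apply Rmin_l|lra].
  - apply lipschitz_box_le with r2 L2; auto; [apply Rmin_r|lra].
Qed.

(** * One-sided Lipschitz estimate for the hull *)

Ltac Fsys_cases := unfold Fsys; cbn [fst snd];
  repeat match goal with
  | |- context [Rlt_dec ?x ?y] => destruct (Rlt_dec x y)
  | |- context [Req_EM_T ?x ?y] => destruct (Req_EM_T x y)
  end.

Ltac Rabs_split := unfold Rabs in *; repeat match goal with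
  | |- context [Rcase_abs ?x] => destruct (Rcase_abs x)
  | H : context [Rcase_abs ?x] |- _ => destruct (Rcase_abs x)
  end.

Lemma Fsys_decreasing G H w1 w2 :
  snd w2 < snd w1 ->
  snd (Fsys G H w1) - snd (Fsys G H w2) <= Rabs (H (fst w1) (snd w1) - H (fst w2) (snd w2)).
Proof.
  destruct w1 as [x1 y1], w2 as [x2 y2]. cbn [fst snd]. intros Hy.
  Fsys_cases; try lra; Rabs_split; lra.
Qed.

(** For the vertical bound the radius is kept below half the height gap, so every point near [z1]
    lies above every point near [z2] and monotonicity applies. At equal heights no such order
    exists, but the vertical term is then multiplied by zero in the scalar product. *)
Lemma Fsys_pair G H x0 y0 r L z1 z2 v1 v2 :
  0 < r -> 0 < L -> lipschitz_box G x0 y0 r L -> lipschitz_box H x0 y0 r L ->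
  Rabs (fst z1 - x0) <= r / 2 -> Rabs (snd z1 - y0) <= r / 2 ->
  Rabs (fst z2 - x0) <= r / 2 -> Rabs (snd z2 - y0) <= r / 2 ->
  filippov_K (Fsys G H) z1 v1 -> filippov_K (Fsys G H) z2 v2 ->
  fst v1 - fst v2 <= L * (Rabs (fst z1 - fst z2) + Rabs (snd z1 - snd z2)) /\
  (snd z2 < snd z1 ->
   snd v1 - snd v2 <= L * (Rabs (fst z1 - fst z2) + Rabs (snd z1 - snd z2))).
Proof.
  intros Hr HL HG HH Hx1 Hy1 Hx2 Hy2 K1 K2.
  (* The term [4 * del] counts two points, each displaced by less than [del] in two coordinates. *)
  assert (Hlip : forall f del w1 w2, lipschitz_box f x0 y0 r L -> del <= r / 2 ->
    dist2 w1 z1 < del -> dist2 w2 z2 < del ->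
    Rabs (f (fst w1) (snd w1) - f (fst w2) (snd w2)) <=
      L * (Rabs (fst z1 - fst z2) + Rabs (snd z1 - snd z2) + 4 * del)).
  { intros f del w1 w2 Hf Hdel Hw1 Hw2. apply dist2_coord in Hw1. apply dist2_coord in Hw2.
    eapply Rle_trans; [apply Hf|]; try (Rabs_split; lra).
    apply Rmult_le_compat_l; [lra|]. Rabs_split; lra. }
  assert (He : forall eps, 0 < eps -> 4 * L * (eps / (4 * L)) = eps) by (intros; field; lra).
  split.
  - assert (1 * (fst v1 - fst v2) + 0 * (snd v1 - snd v2) <=
      L * (Rabs (fst z1 - fst z2) + Rabs (snd z1 - snd z2))); [|lra].
    apply (filippov_K_pair _ _ _ _ _ _ _ _ K1 K2). intros eps Heps.
    exists (Rmin (r / 2) (eps / (4 * L))). split; [apply Rmin_glb_lt; [lra|apply Rdiv_lt_0_compat; lra]|].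
    intros w1 w2 Hw1 Hw2. assert (E := Hlip G _ w1 w2 HG (Rmin_l _ _) Hw1 Hw2).
    assert (E' := Rmult_le_compat_l (4 * L) _ _ ltac:(lra) (Rmin_r (r / 2) (eps / (4 * L)))).
    rewrite He in E' by assumption. unfold Fsys at 1 2; cbn [fst].
    apply Rabs_le_between in E. lra.
  - intros Hlt.
    assert (0 * (fst v1 - fst v2) + 1 * (snd v1 - snd v2) <=
      L * (Rabs (fst z1 - fst z2) + Rabs (snd z1 - snd z2))); [|lra].
    apply (filippov_K_pair _ _ _ _ _ _ _ _ K1 K2). intros eps Heps.
    exists (Rmin (Rmin (r / 2) (eps / (4 * L))) ((snd z1 - snd z2) / 2)).
    split; [repeat apply Rmin_glb_lt; try lra; apply Rdiv_lt_0_compat; lra|].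
    assert (M1 := Rmin_l (Rmin (r / 2) (eps / (4 * L))) ((snd z1 - snd z2) / 2)).
    assert (M2 := Rmin_r (Rmin (r / 2) (eps / (4 * L))) ((snd z1 - snd z2) / 2)).
    assert (M3 := Rmin_l (r / 2) (eps / (4 * L))).
    assert (M4 := Rmin_r (r / 2) (eps / (4 * L))).
    set (del := Rmin (Rmin (r / 2) (eps / (4 * L))) ((snd z1 - snd z2) / 2)) in *.
    intros w1 w2 Hw1 Hw2. assert (E := Hlip H del w1 w2 HH ltac:(lra) Hw1 Hw2).
    assert (E' := Rmult_le_compat_l (4 * L) del (eps / (4 * L)) ltac:(lra) ltac:(lra)).
    rewrite He in E' by assumption.
    apply dist2_coord in Hw1. apply dist2_coord in Hw2.
    assert (Hw : snd w2 < snd w1) by (Rabs_split; lra).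
    assert (E2 := Fsys_decreasing G H w1 w2 Hw). lra.
Qed.

(** The scalar product is at most $L(|dx|+|dy|)^2$, and the factor 2 comes from $(|dx|+|dy|)^2 \le
    2(dx^2+dy^2)$. *)
Lemma Fsys_one_sided_lipschitz G H x0 y0 r L z1 z2 v1 v2 :
  0 < r -> 0 < L -> lipschitz_box G x0 y0 r L -> lipschitz_box H x0 y0 r L ->
  Rabs (fst z1 - x0) <= r / 2 -> Rabs (snd z1 - y0) <= r / 2 ->
  Rabs (fst z2 - x0) <= r / 2 -> Rabs (snd z2 - y0) <= r / 2 ->
  filippov_K (Fsys G H) z1 v1 -> filippov_K (Fsys G H) z2 v2 ->
  (fst z1 - fst z2) * (fst v1 - fst v2) + (snd z1 - snd z2) * (snd v1 - snd v2) <=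
    2 * L * ((fst z1 - fst z2) ^ 2 + (snd z1 - snd z2) ^ 2).
Proof.
  intros Hr HL HG HH Hx1 Hy1 Hx2 Hy2 K1 K2.
  destruct (Fsys_pair G H x0 y0 r L z1 z2 v1 v2) as [A1 B1]; auto.
  destruct (Fsys_pair G H x0 y0 r L z2 z1 v2 v1) as [A2 B2]; auto.
  rewrite (Rabs_minus_sym (fst z2)), (Rabs_minus_sym (snd z2)) in A2, B2.
  set (dx := fst z1 - fst z2) in *. set (dy := snd z1 - snd z2) in *.
  set (D := L * (Rabs dx + Rabs dy)) in *.
  assert (E1 : dx * (fst v1 - fst v2) <= Rabs dx * D).
  { eapply Rle_trans; [apply Rle_abs|]. rewrite Rabs_mult.
    apply Rmult_le_compat_l; [apply Rabs_pos|]. apply Rabs_le_between. lra. }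
  assert (E2 : dy * (snd v1 - snd v2) <= Rabs dy * D).
  { destruct (Rtotal_order (snd z1) (snd z2)) as [Hlt|[Heq|Hgt]].
    - rewrite Rabs_left by (unfold dy; lra).
      apply Rle_trans with ((- dy) * (snd v2 - snd v1)); [right; ring|].
      apply Rmult_le_compat_l; [unfold dy; lra|auto].
    - replace dy with 0 by (unfold dy; lra). rewrite Rabs_R0. lra.
    - rewrite Rabs_right by (unfold dy; lra). apply Rmult_le_compat_l; [unfold dy; lra|auto]. }
  apply Rle_trans with ((Rabs dx + Rabs dy) * D); [lra|]. unfold D.
  rewrite <- (pow2_abs dx), <- (pow2_abs dy).
  assert (0 <= L * (Rabs dx - Rabs dy) ^ 2) by (apply Rmult_le_pos; [lra|apply pow2_ge_0]).
  lra.
Qed.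

(** * Forward uniqueness and invariance of the strip *)

Lemma abs_cont1_square_gap f g lo hi B :
  (forall t, lo <= t <= hi -> Rabs (f t - g t) <= B) ->
  abs_cont1 f lo hi -> abs_cont1 g lo hi -> abs_cont1 (fun t => (f t - g t) ^ 2) lo hi.
Proof.
  intros HB Hf Hg. apply abs_cont1_dominated with f g (2 * Rabs B + 1); auto.
  { assert (0 <= Rabs B) by apply Rabs_pos. lra. }
  intros s t Hs Ht. assert (Bs := HB s Hs). assert (Bt := HB t Ht).
  replace ((f t - g t) ^ 2 - (f s - g s) ^ 2) with
    (((f t - g t) + (f s - g s)) * ((f t - f s) - (g t - g s))) by ring.
  rewrite Rabs_mult. apply Rmult_le_compat; try apply Rabs_pos; Rabs_split; lra.
Qed.

Lemma derivable_pt_lim_square_gap f g t a b :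
  derivable_pt_lim f t a -> derivable_pt_lim g t b ->
  derivable_pt_lim (fun s => (f s - g s) ^ 2) t (2 * ((f t - g t) * (a - b))).
Proof.
  intros Hf Hg. assert (Hd := derivable_pt_lim_minus f g t a b Hf Hg).
  replace (2 * ((f t - g t) * (a - b))) with ((a - b) * (f t - g t) + (f t - g t) * (a - b)) by ring.
  apply derivable_pt_lim_ext with ((f - g) * (f - g))%F.
  - intros s. unfold mult_fct, minus_fct. ring.
  - apply (derivable_pt_lim_mult (f - g)%F (f - g)%F); assumption.
Qed.

(** The Lipschitz constant is only local, so the argument starts at the last coincidence time [s]
    before a supposed difference. Both curves remain in one box for a short while after [s], and
    Gronwall makes them agree at some later [q], a contradiction. *)
Lemma Fsys_unique G H T1 T2 z1 z2 t :
  C1_2 G -> C1_2 H ->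
  filippov_sol (Fsys G H) T1 z1 -> filippov_sol (Fsys G H) T2 z2 -> z1 0 = z2 0 ->
  0 <= t -> t <= T1 -> t <= T2 -> z1 t = z2 t.
Proof.
  intros HG HH (HT1 & [Ax1 Ay1] & N1 & HN1 & S1) (HT2 & [Ax2 Ay2] & N2 & HN2 & S2) H0 Ht0 Ht1 Ht2.
  apply (abs_cont1_sub _ _ _ 0 t) in Ax1; try lra. apply (abs_cont1_sub _ _ _ 0 t) in Ay1; try lra.
  apply (abs_cont1_sub _ _ _ 0 t) in Ax2; try lra. apply (abs_cont1_sub _ _ _ 0 t) in Ay2; try lra.
  pose (gap := fun s => Rabs (fst (z1 s) - fst (z2 s)) + Rabs (snd (z1 s) - snd (z2 s))).
  assert (Hgap : abs_cont1 gap 0 t).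
  { apply abs_cont1_dominated with
      (fun s => Rabs (fst (z1 s) - fst (z2 s))) (fun s => Rabs (snd (z1 s) - snd (z2 s))) 1; [lra| | |].
    - intros r s _ _. unfold gap. Rabs_split; lra.
    - apply abs_cont1_dominated with (fun s => fst (z1 s)) (fun s => fst (z2 s)) 1; auto; [lra|].
      intros r s _ _. Rabs_split; lra.
    - apply abs_cont1_dominated with (fun s => snd (z1 s)) (fun s => snd (z2 s)) 1; auto; [lra|].
      intros r s _ _. Rabs_split; lra. }
  assert (Hgap0 : forall s, gap s <= 0 -> z1 s = z2 s).
  { intros s Hs. unfold gap in Hs. rewrite (surjective_pairing (z1 s)), (surjective_pairing (z2 s)).
    f_equal; Rabs_split; lra. }
  apply Hgap0. apply Rnot_lt_le. intros Hpos.
  destruct (last_below gap 0 t 0) as (s & Hs & Hgs & Habove); auto.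
  { unfold gap. rewrite H0, !Rminus_diag, Rabs_R0. lra. }
  apply Hgap0 in Hgs.
  pose (x0 := fst (z1 s)). pose (y0 := snd (z1 s)).
  destruct (C1_lipschitz_box2 G H x0 y0 HG HH) as (r & L & Hr & HL & HG' & HH').
  assert (Hnear : forall f, abs_cont1 f 0 t -> exists d, 0 < d /\ forall q, s <= q <= t -> q < s + d ->
    Rabs (f q - f s) <= r / 2).
  { intros f Hf. destruct (abs_cont1_continuous f 0 t (r / 2) Hf) as [d [Hd Hd']]; [lra|].
    exists d. split; [assumption|]. intros q Hq Hqd. left. apply Hd'; try lra. rewrite Rabs_right; lra. }
  destruct (Hnear _ Ax1) as [d1 [Hd1 E1]]. destruct (Hnear _ Ay1) as [d2 [Hd2 E2]].
  destruct (Hnear _ Ax2) as [d3 [Hd3 E3]]. destruct (Hnear _ Ay2) as [d4 [Hd4 E4]].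
  (* The rate is [4 * L] because the derivative of the squared distance is twice the scalar product.
     Halving the minimum [m] makes the bounds on [q] strict. *)
  assert (Hq : exists q, s < q <= t /\ q < s + d1 /\ q < s + d2 /\ q < s + d3 /\ q < s + d4 /\
     (4 * L) * (q - s) <= / 2).
  { pose (m := Rmin (Rmin (Rmin d1 d2) (Rmin d3 d4)) (Rmin (t - s) (/ (8 * L)))).
    assert (Hi : 0 < / (8 * L)) by (apply Rinv_0_lt_compat; lra).
    assert (Hm : 0 < m) by (unfold m; repeat apply Rmin_glb_lt; lra).
    assert (Hm' : m <= d1 /\ m <= d2 /\ m <= d3 /\ m <= d4 /\ m <= t - s /\ m <= / (8 * L)).
    { unfold m. clear. minmax; lra. }
    exists (s + m / 2). repeat (split; [lra|]).
    apply Rle_trans with (4 * L * (/ (8 * L))); [apply Rmult_le_compat_l; lra|right; field; lra]. }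
  destruct Hq as (q & Hsq & Q1 & Q2 & Q3 & Q4 & Hsmall).
  assert (Hbox : forall p, s <= p <= q ->
     (Rabs (fst (z1 p) - x0) <= r / 2 /\ Rabs (snd (z1 p) - y0) <= r / 2) /\
     (Rabs (fst (z2 p) - x0) <= r / 2 /\ Rabs (snd (z2 p) - y0) <= r / 2)).
  { intros p Hp. specialize (E1 p ltac:(lra) ltac:(lra)). specialize (E2 p ltac:(lra) ltac:(lra)).
    specialize (E3 p ltac:(lra) ltac:(lra)). specialize (E4 p ltac:(lra) ltac:(lra)).
    unfold x0, y0. rewrite <- Hgs in E3, E4. tauto. }
  pose (u := fun p => (fst (z1 p) - fst (z2 p)) ^ 2 + (snd (z1 p) - snd (z2 p)) ^ 2).
  assert (Hu : u q <= 0).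
  { apply (gronwall_zero u s q (4 * L) (fun p => N1 p \/ N2 p)); try lra.
    - unfold u.
      apply abs_cont1_dominated with (fun p => (fst (z1 p) - fst (z2 p)) ^ 2)
        (fun p => (snd (z1 p) - snd (z2 p)) ^ 2) 1; [lra| | |].
      + intros p p' _ _. Rabs_split; lra.
      + apply abs_cont1_square_gap with r; [|apply abs_cont1_sub with 0 t; auto; lra ..].
        intros p Hp. destruct (Hbox p Hp) as [[] []]. Rabs_split; lra.
      + apply abs_cont1_square_gap with r; [|apply abs_cont1_sub with 0 t; auto; lra ..].
        intros p Hp. destruct (Hbox p Hp) as [[] []]. Rabs_split; lra.
    - apply null1_union; assumption.
    - unfold u. rewrite Hgs, !Rminus_diag. lra.
    - intros p Hp. unfold u.
      assert (P1 := pow2_ge_0 (fst (z1 p) - fst (z2 p))). assert (P2 := pow2_ge_0 (snd (z1 p) - snd (z2 p))). lra.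
    - intros p Hp HNp. apply not_or_and in HNp. destruct HNp as [HNp1 HNp2].
      destruct (S1 p ltac:(lra) HNp1) as (v1 & Dx1 & Dy1 & K1).
      destruct (S2 p ltac:(lra) HNp2) as (v2 & Dx2 & Dy2 & K2).
      exists (2 * ((fst (z1 p) - fst (z2 p)) * (fst v1 - fst v2)) +
              2 * ((snd (z1 p) - snd (z2 p)) * (snd v1 - snd v2))). split.
      + unfold u.
        apply (derivable_pt_lim_plus (fun p => (fst (z1 p) - fst (z2 p)) ^ 2) (fun p => (snd (z1 p) - snd (z2 p)) ^ 2));
        [apply (derivable_pt_lim_square_gap (fun p => fst (z1 p)) (fun p => fst (z2 p)))|
         apply (derivable_pt_lim_square_gap (fun p => snd (z1 p)) (fun p => snd (z2 p)))]; assumption.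
      + destruct (Hbox p ltac:(lra)) as [[] []].
        assert (OSL := Fsys_one_sided_lipschitz G H x0 y0 r L (z1 p) (z2 p) v1 v2 Hr HL HG' HH'
          ltac:(assumption) ltac:(assumption) ltac:(assumption) ltac:(assumption) K1 K2).
        unfold u. lra. }
  specialize (Habove q Hsq). unfold gap in Habove. unfold u in Hu.
  rewrite <- (pow2_abs (fst (z1 q) - _)), <- (pow2_abs (snd (z1 q) - _)) in Hu.
  set (a := Rabs (fst (z1 q) - fst (z2 q))) in *. set (b := Rabs (snd (z1 q) - snd (z2 q))) in *.
  assert (Ha : 0 <= a) by apply Rabs_pos. assert (Hb : 0 <= b) by apply Rabs_pos.
  destruct (Rle_lt_or_eq_dec 0 a Ha) as [Ha'|Ha'].
  - assert (0 < a ^ 2) by (apply pow_lt; assumption). assert (0 <= b ^ 2) by (apply pow2_ge_0). lra.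
  - assert (0 < b ^ 2) by (apply pow_lt; lra). assert (0 <= a ^ 2) by (apply pow2_ge_0). lra.
Qed.

Lemma Fsys_strip_invariant G H T z t :
  filippov_sol (Fsys G H) T z -> 0 <= snd (z 0) <= 1 -> 0 <= t <= T -> 0 <= snd (z t) <= 1.
Proof.
  intros (HT & [_ Ay] & N & HN & S) H0 Ht. split.
  - assert (- snd (z t) <= 0); [|lra].
    apply (stays_below (fun s => - snd (z s)) T 0 N); auto; [|lra|].
    + apply abs_cont1_dominated with (fun s => snd (z s)) (fun s => snd (z s)) 1; auto; [lra|].
      intros p p' _ _. Rabs_split; lra.
    + intros s Hs HNs Hneg. destruct (S s Hs HNs) as (v & _ & Dy & K).
      exists (- snd v). split.
      * apply (derivable_pt_lim_opp (fun s => snd (z s))). assumption.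
      * assert (0 * fst v + -1 * snd v <= 0); [|lra].
        (* The radius is the distance to the strip, so the whole ball lies below it, where the
           vertical field is $|H| \ge 0$. *)
        apply (filippov_K_halfplane _ _ _ _ _ _ (- snd (z s)) K); [lra|].
        intros [x y] Hw. apply dist2_coord in Hw. simpl in Hw.
        assert (y < 0) by (Rabs_split; lra). Fsys_cases; Rabs_split; lra.
  - apply (stays_below (fun s => snd (z s)) T 1 N); auto; [lra|].
    intros s Hs HNs Hneg. destruct (S s Hs HNs) as (v & _ & Dy & K).
    exists (snd v). split; [assumption|].
    assert (0 * fst v + 1 * snd v <= 0); [|lra].
    apply (filippov_K_halfplane _ _ _ _ _ _ (snd (z s) - 1) K); [lra|].
    intros [x y] Hw. apply dist2_coord in Hw. simpl in Hw.
    assert (1 < y) by (Rabs_split; lra). Fsys_cases; Rabs_split; lra.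
Qed.

(** * Vectors in the Filippov hull *)

(** A limit of [F] along open rectangles shrinking to [z], which removing a null set cannot destroy.
    The rectangles need not contain [z], so one-sided limits qualify. *)
Definition robust_value (F : pt -> pt) (z v : pt) : Prop :=
  forall eps, 0 < eps -> exists a b c d, a < b /\ c < d /\
    forall w, a < fst w < b -> c < snd w < d -> dist2 w z < eps /\ dist2 (F w) v < eps.

(** Each rectangle keeps a point outside [N], and the average of the two field values there is an
    admissible convex combination. *)
Lemma filippov_K_midpoint F z v1 v2 :
  robust_value F z v1 -> robust_value F z v2 ->
  filippov_K F z ((fst v1 + fst v2) / 2, (snd v1 + snd v2) / 2).
Proof.
  intros H1 H2 delta Hdelta N HN eps Heps.
  pose (e := Rmin delta (eps / 2)).
  assert (He : 0 < e /\ e <= delta /\ e <= eps / 2).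
  { split; [apply Rmin_glb_lt; lra|]. split; [apply Rmin_l|apply Rmin_r]. }
  destruct (H1 e) as (a1 & b1 & c1 & d1 & Hab1 & Hcd1 & Hw1); [lra|].
  destruct (H2 e) as (a2 & b2 & c2 & d2 & Hab2 & Hcd2 & Hw2); [lra|].
  destruct (box_not_null N a1 b1 c1 d1 HN Hab1 Hcd1) as (w1 & A1 & C1 & N1).
  destruct (box_not_null N a2 b2 c2 d2 HN Hab2 Hcd2) as (w2 & A2 & C2 & N2).
  destruct (Hw1 w1 A1 C1) as [D1 E1]. destruct (Hw2 w2 A2 C2) as [D2 E2].
  exists (wsum ((/ 2, F w1) :: (/ 2, F w2) :: nil)). split.
  - exists ((/ 2, F w1) :: (/ 2, F w2) :: nil). split; [|split; [simpl; lra|reflexivity]].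
    constructor; [split; [simpl; lra|exists w1; repeat split; auto; lra]|].
    constructor; [split; [simpl; lra|exists w2; repeat split; auto; lra]|constructor].
  - eapply Rle_lt_trans; [apply dist2_le|]. unfold wsum; simpl.
    apply dist2_coord in E1. apply dist2_coord in E2. Rabs_split; lra.
Qed.

(** Here [(G, K)] is a Lipschitz extension of the field from thin horizontal layers next to height
    [y], possibly on one side only. Each component then varies by less than [2 * L * e], whence the
    bound [eps / (4 * L)]. *)
Lemma robust_value_limit F G K x y r L :
  0 < r -> 0 < L -> lipschitz_box G x y r L -> lipschitz_box K x y r L ->
  (forall eta, 0 < eta -> exists c d, c < d /\ y - eta <= c /\ d <= y + eta /\
     forall x' y', c < y' < d -> F (x', y') = (G x' y', K x' y')) ->
  robust_value F (x, y) (G x y, K x y).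
Proof.
  intros Hr HL HG HK HF eps Heps.
  pose (e := Rmin (Rmin r (eps / 2)) (eps / (4 * L))).
  assert (He : 0 < e /\ e <= r /\ e <= eps / 2 /\ e <= eps / (4 * L)).
  { split.
    - repeat apply Rmin_glb_lt; try lra. apply Rdiv_lt_0_compat; lra.
    - unfold e. minmax; lra. }
  assert (HLe : 4 * L * e <= eps).
  { apply Rle_trans with (4 * L * (eps / (4 * L))); [apply Rmult_le_compat_l; lra|right; field; lra]. }
  destruct (HF e) as (c & d & Hcd & Hc & Hd & HFe); [lra|].
  exists (x - e), (x + e), c, d. split; [lra|]. split; [assumption|].
  intros [x' y'] Hx Hy. simpl in Hx, Hy. rewrite HFe by assumption.
  assert (Hx' : Rabs (x' - x) < e) by (apply Rabs_def1; lra).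
  assert (Hy' : Rabs (y' - y) < e) by (apply Rabs_def1; lra).
  split; (eapply Rle_lt_trans; [apply dist2_le|]); simpl; [lra|].
  assert (Z1 : Rabs (x - x) <= r) by (rewrite Rminus_diag, Rabs_R0; lra).
  assert (Z2 : Rabs (y - y) <= r) by (rewrite Rminus_diag, Rabs_R0; lra).
  assert (B1 := HG x' y' x y ltac:(lra) ltac:(lra) Z1 Z2).
  assert (B2 := HK x' y' x y ltac:(lra) ltac:(lra) Z1 Z2).
  assert (B3 : L * (Rabs (x' - x) + Rabs (y' - y)) < L * (2 * e)) by (apply Rmult_lt_compat_l; lra).
  lra.
Qed.

Lemma lipschitz_box_abs f x y r L :
  lipschitz_box f x y r L -> lipschitz_box (fun a b => Rabs (f a b)) x y r L.
Proof.
  intros Hf a b a' b' H1 H2 H3 H4. eapply Rle_trans; [apply Rabs_triang_inv2|]. apply Hf; assumption.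
Qed.

Lemma lipschitz_box_opp f x y r L :
  lipschitz_box f x y r L -> lipschitz_box (fun a b => - f a b) x y r L.
Proof.
  intros Hf a b a' b' H1 H2 H3 H4.
  replace (- f a b - - f a' b') with (- (f a b - f a' b')) by ring.
  rewrite Rabs_Ropp. apply Hf; assumption.
Qed.

Section FsysK.
Context (G H : R -> R -> R) (hG : C1_2 G) (hH : C1_2 H) (x y : R).

(** The layer is taken just above [y], so the lower edge [y = 0] is included; [robust_strip_below]
    takes it just below and includes [y = 1]. With the two outer lemmas, each edge thus has a limit
    from both sides. *)
Lemma robust_strip_above : 0 <= y < 1 -> robust_value (Fsys G H) (x, y) (G x y, H x y).
Proof.
  intros Hy. destruct (C1_lipschitz_box2 G H x y hG hH) as (r & L & Hr & HL & LG & LH).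
  apply robust_value_limit with r L; auto. intros eta Heta.
  exists y, (Rmin 1 (y + eta)).
  split; [apply Rmin_glb_lt; lra|]. split; [lra|]. split; [apply Rmin_r|].
  assert (M := Rmin_l 1 (y + eta)). intros x' y' Hy'. Fsys_cases; try lra; reflexivity.
Qed.

Lemma robust_strip_below : 0 < y <= 1 -> robust_value (Fsys G H) (x, y) (G x y, H x y).
Proof.
  intros Hy. destruct (C1_lipschitz_box2 G H x y hG hH) as (r & L & Hr & HL & LG & LH).
  apply robust_value_limit with r L; auto. intros eta Heta.
  exists (Rmax 0 (y - eta)), y.
  split; [apply Rmax_lub_lt; lra|]. split; [apply Rmax_r|]. split; [lra|].
  assert (M := Rmax_l 0 (y - eta)). intros x' y' Hy'. Fsys_cases; try lra; reflexivity.
Qed.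

Lemma robust_above_strip : 1 <= y -> robust_value (Fsys G H) (x, y) (G x y, - Rabs (H x y)).
Proof.
  intros Hy. destruct (C1_lipschitz_box2 G H x y hG hH) as (r & L & Hr & HL & LG & LH).
  apply (robust_value_limit _ G (fun a b => - Rabs (H a b))) with r L; auto.
  - apply lipschitz_box_opp, lipschitz_box_abs, LH.
  - intros eta Heta. exists y, (y + eta). repeat split; try lra.
    intros x' y' Hy'. Fsys_cases; try lra; reflexivity.
Qed.

Lemma robust_below_strip : y <= 0 -> robust_value (Fsys G H) (x, y) (G x y, Rabs (H x y)).
Proof.
  intros Hy. destruct (C1_lipschitz_box2 G H x y hG hH) as (r & L & Hr & HL & LG & LH).
  apply (robust_value_limit _ G (fun a b => Rabs (H a b))) with r L; auto.
  - apply lipschitz_box_abs, LH.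
  - intros eta Heta. exists (y - eta), y. repeat split; try lra.
    intros x' y' Hy'. Fsys_cases; try lra; reflexivity.
Qed.

End FsysK.

Lemma filippov_K_robust F z v : robust_value F z v -> filippov_K F z v.
Proof.
  intros Hv. replace v with ((fst v + fst v) / 2, (snd v + snd v) / 2).
  - apply filippov_K_midpoint; assumption.
  - rewrite (surjective_pairing v) at 5. f_equal; field.
Qed.

Lemma Fsys_slide_top G H x :
  C1_2 G -> C1_2 H -> 0 <= H x 1 -> filippov_K (Fsys G H) (x, 1) (G x 1, 0).
Proof.
  intros hG hH Hpos.
  replace (G x 1, 0) with ((fst (G x 1, H x 1) + fst (G x 1, - Rabs (H x 1))) / 2,
    (snd (G x 1, H x 1) + snd (G x 1, - Rabs (H x 1))) / 2).
  - apply filippov_K_midpoint; [apply robust_strip_below|apply robust_above_strip]; auto; lra.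
  - simpl. rewrite Rabs_right by lra. f_equal; field.
Qed.

Lemma Fsys_slide_bottom G H x :
  C1_2 G -> C1_2 H -> H x 0 <= 0 -> filippov_K (Fsys G H) (x, 0) (G x 0, 0).
Proof.
  intros hG hH Hneg.
  replace (G x 0, 0) with ((fst (G x 0, H x 0) + fst (G x 0, Rabs (H x 0))) / 2,
    (snd (G x 0, H x 0) + snd (G x 0, Rabs (H x 0))) / 2).
  - apply filippov_K_midpoint; [apply robust_strip_above|apply robust_below_strip]; auto; lra.
  - simpl. rewrite Rabs_left1 by lra. f_equal; field.
Qed.

(** * Skorokhod reflection *)

(** The regulator of the Skorokhod problem, a running maximum over the entire past. The paths fed to
    it later are constant before time 0. [epsilon] makes it total, and [overshoot_lub] identifies it
    whenever [w] is bounded above. *)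
Definition overshoot (c : R) (w : R -> R) (t : R) : R :=
  epsilon (inhabits 0) (is_lub (fun r => r = 0 \/ exists s, s <= t /\ r = w s - c)).

Definition lipschitz (f : R -> R) (M : R) : Prop :=
  forall s t, Rabs (f s - f t) <= M * Rabs (s - t).

Lemma overshoot_lub c w t B :
  (forall s, w s <= B) ->
  is_lub (fun r => r = 0 \/ exists s, s <= t /\ r = w s - c) (overshoot c w t).
Proof.
  intros HB. unfold overshoot. apply epsilon_spec.
  destruct (completeness (fun r => r = 0 \/ exists s, s <= t /\ r = w s - c)) as [m Hm].
  - exists (Rmax 0 (B - c)). intros r [->|[s [_ ->]]]; [apply Rmax_l|].
    specialize (HB s). assert (M := Rmax_r 0 (B - c)). lra.
  - exists 0. left. reflexivity.
  - exists m. exact Hm.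
Qed.

Section Overshoot.
Context (c : R) (w : R -> R) (B : R) (HB : forall s, w s <= B).

Lemma overshoot_ge0 t : 0 <= overshoot c w t.
Proof. apply (overshoot_lub c w t B HB). left. reflexivity. Qed.

Lemma overshoot_ge s t : s <= t -> w s - c <= overshoot c w t.
Proof. intros Hs. apply (overshoot_lub c w t B HB). right. exists s. tauto. Qed.

Lemma overshoot_le t m : 0 <= m -> (forall s, s <= t -> w s - c <= m) -> overshoot c w t <= m.
Proof.
  intros Hm H. apply (overshoot_lub c w t B HB). intros r [->|[s [Hs ->]]]; auto.
Qed.

Lemma overshoot_mono s t : s <= t -> overshoot c w s <= overshoot c w t.
Proof.
  intros Hst. apply overshoot_le; [apply overshoot_ge0|]. intros r Hr. apply overshoot_ge. lra.
Qed.

(** The value at [s] summarises the past, so later bounds only have to inspect [w] on [[s, t]]. *)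
Lemma overshoot_extend s t m :
  overshoot c w s <= m -> (forall r, s <= r <= t -> w r - c <= m) -> overshoot c w t <= m.
Proof.
  intros Hs H. apply overshoot_le.
  - eapply Rle_trans; [apply (overshoot_ge0 s)|assumption].
  - intros r Hr. destruct (Rle_dec s r); [apply H; lra|].
    eapply Rle_trans; [apply (overshoot_ge r s); lra|assumption].
Qed.

Lemma overshoot_lipschitz M : 0 <= M -> lipschitz w M -> lipschitz (overshoot c w) M.
Proof.
  intros HM Hw.
  assert (Hlt : forall s t, s <= t -> overshoot c w t <= overshoot c w s + M * (t - s)).
  { intros s t Hst. assert (0 <= M * (t - s)) by (apply Rmult_le_pos; lra).
    apply overshoot_extend with s; [lra|]. intros r Hr.
    assert (H1 := overshoot_ge s s (Rle_refl s)). specialize (Hw r s).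
    rewrite (Rabs_right (r - s)) in Hw by lra. apply Rabs_le_between in Hw.
    assert (M * (r - s) <= M * (t - s)) by (apply Rmult_le_compat_l; lra). lra. }
  intros s t. destruct (Rle_dec s t) as [Hst|Hst].
  - rewrite Rabs_left1 by (assert (X := overshoot_mono s t Hst); lra). rewrite (Rabs_left1 (s - t)) by lra.
    specialize (Hlt s t Hst). lra.
  - rewrite Rabs_right by (assert (X := overshoot_mono t s ltac:(lra)); lra). rewrite (Rabs_right (s - t)) by lra.
    specialize (Hlt t s ltac:(lra)). lra.
Qed.

End Overshoot.

Lemma overshoot_close c w w' B B' d t :
  (forall s, w s <= B) -> (forall s, w' s <= B') -> 0 <= d ->
  (forall s, Rabs (w s - w' s) <= d) -> Rabs (overshoot c w t - overshoot c w' t) <= d.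
Proof.
  intros HB HB' Hd0 Hd. apply Rabs_le_between'. split.
  - assert (overshoot c w' t <= overshoot c w t + d); [|lra].
    apply (overshoot_le c w' B' HB').
    + assert (X := overshoot_ge0 c w B HB t). lra.
    + intros s Hs. assert (X := overshoot_ge c w B HB s t Hs). specialize (Hd s).
      apply Rabs_le_between in Hd. lra.
  - apply (overshoot_le c w B HB).
    + assert (X := overshoot_ge0 c w' B' HB' t). lra.
    + intros s Hs. assert (X := overshoot_ge c w' B' HB' s t Hs). specialize (Hd s).
      apply Rabs_le_between in Hd. lra.
Qed.

Definition reflect (c : R) (w : R -> R) (t : R) : R := w t - overshoot c w t.

Lemma lipschitz_continuous f M : lipschitz f M -> forall t, continuity_pt f t.
Proof.
  intros Hf t eps Heps. exists (eps / (Rabs M + 1)).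
  assert (HM := Rabs_pos M).
  assert (Hd : 0 < eps / (Rabs M + 1)) by (apply Rdiv_lt_0_compat; lra).
  split; [assumption|]. intros s [_ Hs]. simpl in *. unfold R_dist in *.
  apply Rle_lt_trans with ((Rabs M + 1) * Rabs (s - t) - Rabs (s - t)).
  - eapply Rle_trans; [apply Hf|].
    replace ((Rabs M + 1) * Rabs (s - t) - Rabs (s - t)) with (Rabs M * Rabs (s - t)) by ring.
    apply Rmult_le_compat_r; [apply Rabs_pos|apply Rle_abs].
  - assert ((Rabs M + 1) * Rabs (s - t) < eps).
    { apply Rlt_le_trans with ((Rabs M + 1) * (eps / (Rabs M + 1))); [apply Rmult_lt_compat_l; lra|].
      right. field. lra. }
    assert (0 <= Rabs (s - t)) by apply Rabs_pos. lra.
Qed.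

(** * Primitives clamped to a time interval *)

Definition clamp (lo hi t : R) : R := Rmax lo (Rmin t hi).

Lemma clamp_range lo hi t : lo <= hi -> lo <= clamp lo hi t <= hi.
Proof. unfold clamp. intros. minmax; lra. Qed.

Lemma clamp_id lo hi t : lo <= t <= hi -> clamp lo hi t = t.
Proof. unfold clamp. intros. minmax; lra. Qed.

Lemma clamp_lipschitz lo hi s t : lo <= hi -> Rabs (clamp lo hi s - clamp lo hi t) <= Rabs (s - t).
Proof. unfold clamp. intros. minmax; Rabs_split; lra. Qed.

Lemma ex_RInt_lipschitz f M a b : lipschitz f M -> ex_RInt f a b.
Proof.
  intros Hf. apply (ex_RInt_continuous (V := R_CompleteNormedModule)). intros z _. apply continuity_pt_filterlim.
  apply (lipschitz_continuous f M Hf).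
Qed.

Lemma RInt_bound f M a b C :
  lipschitz f M -> (forall t, Rabs (f t) <= C) -> Rabs (RInt f a b) <= C * Rabs (b - a).
Proof.
  intros Hf HC. destruct (Rle_dec a b) as [Hab|Hab].
  - rewrite (Rabs_right (b - a)) by lra. rewrite Rmult_comm.
    apply abs_RInt_le_const; auto. apply ex_RInt_lipschitz with M, Hf.
  - rewrite <- (opp_RInt_swap f b a) by (apply ex_RInt_lipschitz with M, Hf).
    change (opp (RInt f b a)) with (- RInt f b a). rewrite Rabs_Ropp.
    rewrite (Rabs_left1 (b - a)) by lra. replace (C * - (b - a)) with ((a - b) * C) by ring.
    apply abs_RInt_le_const; auto; [lra|]. apply ex_RInt_lipschitz with M, Hf.
Qed.

(** Clamping the time makes the primitive bounded and Lipschitz on the whole line and constant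
    before 0, as [overshoot] requires. *)
Definition primitive (T y0 : R) (f : R -> R) (t : R) : R := y0 + RInt f 0 (clamp 0 T t).

Lemma primitive_lipschitz T y0 f M C :
  0 <= T -> lipschitz f M -> (forall t, Rabs (f t) <= C) -> lipschitz (primitive T y0 f) C.
Proof.
  intros HT Hf HC s t. unfold primitive.
  assert (Hch : RInt f 0 (clamp 0 T t) + RInt f (clamp 0 T t) (clamp 0 T s) = RInt f 0 (clamp 0 T s)).
  { apply (RInt_Chasles (V := R_CompleteNormedModule)); apply ex_RInt_lipschitz with M, Hf. }
  rewrite <- Hch.
  assert (E : forall p q : R, y0 + (p + q) - (y0 + p) = q) by (intros; ring). rewrite E.
  eapply Rle_trans; [apply (RInt_bound f M _ _ C Hf HC)|].
  apply Rmult_le_compat_l; [|apply clamp_lipschitz; assumption].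
  eapply Rle_trans; [apply Rabs_pos|apply (HC 0)].
Qed.

Lemma primitive_close T y0 f g M M' d t :
  0 <= T -> lipschitz f M -> lipschitz g M' -> (forall s, Rabs (f s - g s) <= d) ->
  Rabs (primitive T y0 f t - primitive T y0 g t) <= T * d.
Proof.
  intros HT Hf Hg Hd. unfold primitive.
  replace (y0 + RInt f 0 (clamp 0 T t) - (y0 + RInt g 0 (clamp 0 T t)))
    with (RInt f 0 (clamp 0 T t) - RInt g 0 (clamp 0 T t)) by ring.
  assert (Hm : RInt (fun s => f s - g s) 0 (clamp 0 T t) =
    RInt f 0 (clamp 0 T t) - RInt g 0 (clamp 0 T t)).
  { apply (RInt_minus (V := R_CompleteNormedModule)); eapply ex_RInt_lipschitz; eassumption. }
  rewrite <- Hm.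
  assert (Hr := clamp_range 0 T t HT).
  eapply Rle_trans; [apply (abs_RInt_le_const _ 0 (clamp 0 T t) d); [lra| |]|].
  - apply (ex_RInt_minus (V := R_CompleteNormedModule)); eapply ex_RInt_lipschitz; eassumption.
  - intros s _. apply Hd.
  - apply Rmult_le_compat_r; [|lra]. eapply Rle_trans; [apply Rabs_pos|apply (Hd 0)].
Qed.

Lemma primitive_past T y0 f t : 0 <= T -> t <= 0 -> primitive T y0 f t = y0.
Proof.
  intros HT Ht. unfold primitive. replace (clamp 0 T t) with 0 by (unfold clamp; minmax; lra).
  rewrite RInt_point. apply Rplus_0_r.
Qed.

Lemma primitive_derivative T y0 f M t :
  lipschitz f M -> 0 < t < T -> derivable_pt_lim (primitive T y0 f) t (f t).
Proof.
  intros Hf Ht.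
  assert (Hd : derivable_pt_lim (fun s => RInt f 0 s) t (f t)).
  { apply is_derive_Reals. apply (is_derive_RInt (V := R_CompleteNormedModule)) with 0.
    - apply filter_forall. intros s. apply (RInt_correct (V := R_CompleteNormedModule)).
      apply ex_RInt_lipschitz with M, Hf.
    - apply continuity_pt_filterlim. apply (lipschitz_continuous f M Hf). }
  intros eps Heps. destruct (Hd eps Heps) as [del Hdel].
  assert (Hpos : 0 < Rmin del (Rmin t (T - t))).
  { assert (X := cond_pos del). repeat apply Rmin_glb_lt; lra. }
  exists (mkposreal _ Hpos). simpl. intros h Hh Hhd.
  assert (Hh' : Rabs h < del /\ Rabs h < t /\ Rabs h < T - t).
  { split; [|split]; (eapply Rlt_le_trans; [exact Hhd|]); minmax; lra. }
  unfold primitive. rewrite !clamp_id by (Rabs_split; lra).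
  replace (y0 + RInt f 0 (t + h) - (y0 + RInt f 0 t)) with (RInt f 0 (t + h) - RInt f 0 t) by ring.
  apply Hdel; tauto.
Qed.

Lemma geometric_limit (u : nat -> R -> R) C :
  0 <= C -> (forall n t, Rabs (u (S n) t - u n t) <= C / 2 ^ n) ->
  exists l, forall n t, Rabs (l t - u n t) <= 2 * C / 2 ^ n.
Proof.
  intros HC Hu.
  assert (Hp : forall n, 0 < 2 ^ n) by (intros; apply pow_lt; lra).
  (* The subtracted tail makes the telescoping estimate close under induction. *)
  assert (Hk : forall t n k, Rabs (u (n + k)%nat t - u n t) <= 2 * C / 2 ^ n - 2 * C / 2 ^ (n + k)).
  { intros t n. induction k as [|k IH].
    - rewrite Nat.add_0_r, !Rminus_diag, Rabs_R0. lra.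
    - replace (n + S k)%nat with (S (n + k)) by lia. specialize (Hu (n + k)%nat t).
      replace (2 * C / 2 ^ S (n + k)) with (C / 2 ^ (n + k)) by (simpl; field; specialize (Hp (n + k)%nat); lra).
      replace (2 * C / 2 ^ (n + k)) with (2 * (C / 2 ^ (n + k))) in IH by (field; specialize (Hp (n + k)%nat); lra).
      Rabs_split; lra. }
  assert (Hnm : forall t n m, (n <= m)%nat -> Rabs (u m t - u n t) <= 2 * C / 2 ^ n).
  { intros t n m Hle. specialize (Hk t n (m - n)%nat). replace (n + (m - n))%nat with m in Hk by lia.
    assert (0 <= 2 * C / 2 ^ m) by (apply Rdiv_le_0_compat; [lra|apply Hp]). lra. }
  assert (Hcv : forall t, exists l, forall n, Rabs (l - u n t) <= 2 * C / 2 ^ n).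
  { intros t. destruct (Rcomplete.R_complete (fun n => u n t)) as [l Hl].
    - intros eps Heps.
      assert (HN : exists N, 2 * C / 2 ^ N <= eps / 3).
      { apply NNPP. intros Hno. assert (eps / 3 <= 0); [|lra].
        apply le_halving with (2 * C); [lra|]. intros n. rewrite Rplus_0_l.
        apply Rnot_lt_le. intros Hlt. apply Hno. exists n. lra. }
      destruct HN as [N HN]. exists N. intros n m Hn Hm. unfold R_dist.
      assert (A := Hnm t N n Hn). assert (B := Hnm t N m Hm). Rabs_split; lra.
    - exists l. intros n. apply le_epsilon. intros eps Heps.
      destruct (Hl eps Heps) as [N HN]. specialize (HN (Nat.max n N) ltac:(lia)). unfold R_dist in HN.
      assert (A := Hnm t n (Nat.max n N) ltac:(lia)). Rabs_split; lra. }
  exists (fun t => proj1_sig (constructive_indefinite_description _ (Hcv t))).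
  intros n t. destruct (constructive_indefinite_description _ (Hcv t)) as [l Hl]. apply Hl.
Qed.

Lemma primitive_bound T y0 f M C t :
  0 <= T -> lipschitz f M -> (forall t, Rabs (f t) <= C) -> Rabs (primitive T y0 f t - y0) <= C * T.
Proof.
  intros HT Hf HC. unfold primitive.
  assert (E : forall p : R, y0 + p - y0 = p) by (intros; ring). rewrite E.
  assert (Hr := clamp_range 0 T t HT).
  eapply Rle_trans; [apply (RInt_bound f M _ _ C Hf HC)|].
  apply Rmult_le_compat_l; [eapply Rle_trans; [apply Rabs_pos|apply (HC 0)]|].
  rewrite Rabs_right; lra.
Qed.

Lemma reflect_lipschitz c w B M :
  0 <= M -> (forall s, w s <= B) -> lipschitz w M -> lipschitz (reflect c w) (2 * M).
Proof.
  intros HM HB Hw s t. unfold reflect.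
  assert (H1 := Hw s t). assert (H2 := overshoot_lipschitz c w B HB M HM Hw s t).
  replace (w s - overshoot c w s - (w t - overshoot c w t)) with
    ((w s - w t) - (overshoot c w s - overshoot c w t)) by ring.
  eapply Rle_trans; [apply Rabs_triang|]. rewrite Rabs_Ropp. lra.
Qed.

(** * Picard iteration for the reflected equation *)

Definition lipschitz2 (f : R -> R -> R) (L : R) : Prop :=
  forall x y x' y', Rabs (f x y - f x' y') <= L * (Rabs (x - x') + Rabs (y - y')).

Section Picard.
Context (g h : R -> R -> R) (x0 y0 c L M T : R).
Context (HL : 0 <= L) (HM : 0 <= M) (HT : 0 <= T) (HLT : 6 * L * T <= 1).
Context (Hg : lipschitz2 g L) (Hh : lipschitz2 h L).
Context (Bg : forall x y, Rabs (g x y) <= M) (Bh : forall x y, Rabs (h x y) <= M).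

Definition along (f : R -> R -> R) (p : (R -> R) * (R -> R)) (s : R) : R :=
  f (fst p s) (reflect c (snd p) s).

Definition picard (p : (R -> R) * (R -> R)) : (R -> R) * (R -> R) :=
  (primitive T x0 (along g p), primitive T y0 (along h p)).

(** A class preserved by [picard]; its upper bound guarantees that the running maximum exists. *)
Definition admissible (p : (R -> R) * (R -> R)) : Prop :=
  lipschitz (fst p) M /\ lipschitz (snd p) M /\ forall s, snd p s <= y0 + M * T.

Definition close_within (d : R) (p q : (R -> R) * (R -> R)) : Prop :=
  forall s, Rabs (fst p s - fst q s) <= d /\ Rabs (snd p s - snd q s) <= d.

Lemma along_lipschitz f p : lipschitz2 f L -> admissible p -> lipschitz (along f p) (L * (3 * M)).
Proof.
  intros Hf (H1 & H2 & H3) s t. unfold along. eapply Rle_trans; [apply Hf|].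
  rewrite Rmult_assoc. apply Rmult_le_compat_l; [assumption|].
  assert (A := H1 s t). assert (B := reflect_lipschitz c _ _ M HM H3 H2 s t). lra.
Qed.

Lemma picard_admissible p : admissible p -> admissible (picard p).
Proof.
  intros Hp. assert (A := along_lipschitz g p Hg Hp). assert (B := along_lipschitz h p Hh Hp).
  split; [|split]; simpl.
  - apply primitive_lipschitz with (L * (3 * M)); auto. intros t. apply Bg.
  - apply primitive_lipschitz with (L * (3 * M)); auto. intros t. apply Bh.
  - intros s. assert (C := primitive_bound T y0 _ _ M s HT B ltac:(intros; apply Bh)).
    apply Rabs_le_between in C. lra.
Qed.

(** An error [d] in [w] becomes at most [2 * d] after reflection, and [x] adds another [d]. The
    velocities differ by at most [3 * L * d], their integrals by [3 * L * T * d], which is at most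
    [d / 2] exactly when [6 * L * T <= 1]. *)
Lemma picard_contracts p q d :
  admissible p -> admissible q -> 0 <= d -> close_within d p q ->
  close_within (d / 2) (picard p) (picard q).
Proof.
  intros Hp Hq Hd Hpq.
  assert (Hf : forall f s, lipschitz2 f L -> Rabs (along f p s - along f q s) <= L * (3 * d)).
  { intros f s Hf. unfold along. eapply Rle_trans; [apply Hf|].
    apply Rmult_le_compat_l; [assumption|]. destruct (Hpq s) as [A B].
    assert (C : Rabs (overshoot c (snd p) s - overshoot c (snd q) s) <= d).
    { destruct Hp as (_ & _ & Hp). destruct Hq as (_ & _ & Hq).
      apply overshoot_close with (y0 + M * T) (y0 + M * T); auto. intros r. apply Hpq. }
    unfold reflect. Rabs_split; lra. }
  assert (E : T * (L * (3 * d)) <= d / 2).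
  { apply Rle_trans with ((6 * L * T) * (d / 2)); [right; field|].
    apply Rle_trans with (1 * (d / 2)); [apply Rmult_le_compat_r; lra|lra]. }
  intros s. split; (eapply Rle_trans; [|exact E]); simpl;
    (eapply primitive_close; [assumption|apply along_lipschitz; eassumption|apply along_lipschitz; eassumption|]);
    intros r; apply Hf; assumption.
Qed.

Lemma picard_fixpoint : exists p, admissible p /\
  forall t, fst p t = fst (picard p) t /\ snd p t = snd (picard p) t.
Proof.
  pose (it := fun n => Nat.iter n picard (fun _ => x0, fun _ => y0)).
  assert (HMT : 0 <= M * T) by (apply Rmult_le_pos; assumption).
  assert (Hadm : forall n, admissible (it n)).
  { induction n as [|n IH]; [|apply picard_admissible; exact IH].
    split; [|split]; simpl.
    - intros s t. rewrite Rminus_diag, Rabs_R0. apply Rmult_le_pos; [assumption|apply Rabs_pos].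
    - intros s t. rewrite Rminus_diag, Rabs_R0. apply Rmult_le_pos; [assumption|apply Rabs_pos].
    - intros s. lra. }
  assert (Hp : forall n, 0 < 2 ^ n) by (intros; apply pow_lt; lra).
  assert (Hstep : forall n, close_within (M * T / 2 ^ n) (it (S n)) (it n)).
  { induction n as [|n IH].
    - intros s. simpl. rewrite Rdiv_1_r. split.
      + apply primitive_bound with (L * (3 * M)); auto; [apply along_lipschitz; [assumption|apply (Hadm O)]|].
        intros t. apply Bg.
      + apply primitive_bound with (L * (3 * M)); auto; [apply along_lipschitz; [assumption|apply (Hadm O)]|].
        intros t. apply Bh.
    - replace (M * T / 2 ^ S n) with (M * T / 2 ^ n / 2) by (simpl; field; specialize (Hp n); lra).
      apply (picard_contracts (it (S n)) (it n)); auto.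
      apply Rdiv_le_0_compat; [assumption|apply Hp]. }
  destruct (geometric_limit (fun n => fst (it n)) (M * T) HMT) as [x Hx].
  { intros n t. apply Hstep. }
  destruct (geometric_limit (fun n => snd (it n)) (M * T) HMT) as [w Hw].
  { intros n t. apply Hstep. }
  assert (Hlim : forall (u : nat -> R -> R) l, (forall n t, Rabs (l t - u n t) <= 2 * (M * T) / 2 ^ n) ->
     (forall n, lipschitz (u n) M) -> lipschitz l M).
  { intros u l Hl Hu s t. apply le_halving with (4 * (M * T)); [lra|]. intros n.
    assert (A := Hl n s). assert (B := Hl n t). assert (C := Hu n s t).
    replace (4 * (M * T) / 2 ^ n) with (2 * (2 * (M * T) / 2 ^ n)) by (field; specialize (Hp n); lra).
    replace (l s - l t) with ((l s - u n s) + (u n s - u n t) + - (l t - u n t)) by ring.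
    eapply Rle_trans; [apply Rabs_triang|]. rewrite Rabs_Ropp.
    assert (D := Rabs_triang (l s - u n s) (u n s - u n t)). lra. }
  assert (Ha : admissible (x, w)).
  { split; [|split]; simpl.
    - apply (Hlim (fun n => fst (it n))); auto. intros n. apply Hadm.
    - apply (Hlim (fun n => snd (it n))); auto. intros n. apply Hadm.
    - intros s. apply le_halving with (2 * (M * T)); [lra|]. intros n.
      assert (A := Hw n s). destruct (Hadm n) as (_ & _ & B). specialize (B s).
      apply Rabs_le_between in A. lra. }
  exists (x, w). split; [assumption|]. intros t.
  (* Contraction brings [picard (x, w)] close to [it (S n)], which is also close to [(x, w)];
     letting [n] grow identifies the two. *)
  assert (Hfix : forall n, close_within (M * T / 2 ^ n) (picard (x, w)) (it (S n))).
  { intros n. replace (M * T / 2 ^ n) with (2 * (M * T) / 2 ^ n / 2) by (field; specialize (Hp n); lra).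
    apply (picard_contracts (x, w) (it n)); auto.
    - apply Rdiv_le_0_compat; [lra|apply Hp].
    - intros s. split; [apply Hx|apply Hw]. }
  assert (Hz : forall a b, (forall n, Rabs (a - b) <= 2 * (M * T) / 2 ^ n) -> a = b).
  { intros a b Hab. assert (Rabs (a - b) <= 0).
    { apply le_halving with (2 * (M * T)); [lra|]. intros n. rewrite Rplus_0_l. apply Hab. }
    Rabs_split; lra. }
  assert (Hn2 : forall n, 2 * (M * T) / 2 ^ n = 2 * (M * T / 2 ^ n)) by (intros n; field; specialize (Hp n); lra).
  assert (Hn3 : forall n, 2 * (M * T) / 2 ^ S n = M * T / 2 ^ n) by (intros n; simpl; field; specialize (Hp n); lra).
  assert (Htri : forall a b m d, Rabs (a - m) <= d -> Rabs (b - m) <= d -> Rabs (a - b) <= 2 * d)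
    by (intros; Rabs_split; lra).
  split; apply Hz; intros n; rewrite Hn2; destruct (Hfix n t) as [A B].
  - apply (Htri _ _ (fst (it (S n)) t)); [|exact A]. rewrite <- Hn3. apply Hx.
  - apply (Htri _ _ (snd (it (S n)) t)); [|exact B]. rewrite <- Hn3. apply Hw.
Qed.

End Picard.

(** * Countability of arrival times *)

Lemma null1_countable (u : nat -> R) : null1 (fun t => exists n, t = u n).
Proof.
  intros eps Heps. assert (Hp : forall n, 0 < 2 ^ n) by (intros; apply pow_lt; lra).
  assert (He : forall n, 0 < eps / 2 ^ n) by (intros; apply Rdiv_lt_0_compat; auto).
  exists (fun n => u n - eps / 2 ^ n / 4), (fun n => u n + eps / 2 ^ n / 4). split; [|split].
  - intros n. specialize (He n). lra.
  - intros t [n ->]. exists n. specialize (He n). lra.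
  - intros n. apply Rle_trans with (eps - eps / 2 ^ n / 2); [|specialize (He n); lra].
    induction n as [|n IH]; [simpl; lra|]. rewrite tech5.
    replace (eps / 2 ^ S n) with (eps / 2 ^ n / 2) by (simpl; field; specialize (Hp n); lra). lra.
Qed.

(** Natural numerators and denominators let the Cantor pairing enumerate these rationals; [S q]
    excludes a zero denominator. *)
Lemma nonneg_rational_between s t :
  0 <= s < t -> exists p q, s < INR p / INR (S q) < t.
Proof.
  intros Hst. destruct (archimed_cor1 (t - s)) as [N [HN HN0]]; [lra|].
  destruct N as [|q]; [lia|]. assert (Hq : 0 < INR (S q)) by (apply lt_0_INR; lia).
  destruct (archimed (s * INR (S q))) as [U1 U2].
  assert (0 <= s * INR (S q)) by (apply Rmult_le_pos; lra).
  assert (Hz : (0 <= up (s * INR (S q)))%Z) by (apply le_IZR; lra).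
  exists (Z.to_nat (up (s * INR (S q)))), q. rewrite INR_IZR_INZ, Z2Nat.id by assumption.
  split; apply (Rmult_lt_reg_r (INR (S q))); auto.
  - unfold Rdiv. rewrite Rmult_assoc, Rinv_l, Rmult_1_r by lra. lra.
  - unfold Rdiv. rewrite Rmult_assoc, Rinv_l, Rmult_1_r by lra.
    apply Rmult_lt_compat_r with (r := INR (S q)) in HN; [|assumption].
    rewrite Rinv_l in HN by lra. lra.
Qed.

Definition arrival (c : R) (y : R -> R) (t : R) : Prop :=
  y t = c /\ exists s, 0 <= s < t /\ forall r, s <= r < t -> y r < c.

(* Each arrival time is determined by any rational in the excursion preceding it. *)
Lemma arrival_null c y : null1 (arrival c y).
Proof.
  (* For each [q] at most one [t] qualifies: of two, the smaller would lie inside the excursion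
     preceding the larger. Hence [epsilon] below recovers the arrival time itself. *)
  pose (after := fun q t => q < t /\ y t = c /\ forall r, q <= r < t -> y r < c).
  pose (rat := fun n => INR (fst (Cantor.of_nat n)) / INR (S (snd (Cantor.of_nat n)))).
  pose (u := fun n => epsilon (inhabits 0) (after (rat n))).
  intros eps Heps. destruct (null1_countable u eps Heps) as (a & b & Hab & Hcov & Hsum).
  exists a, b. split; [assumption|]. split; [|assumption].
  intros t (Hyt & s & Hs & Hbelow). apply Hcov.
  destruct (nonneg_rational_between s t Hs) as (p & q & Hpq).
  exists (Cantor.to_nat (p, q)).
  assert (Hr : rat (Cantor.to_nat (p, q)) = INR p / INR (S q)).
  { unfold rat. rewrite Cantor.cancel_of_to. reflexivity. }
  assert (Ht : after (rat (Cantor.to_nat (p, q))) t).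
  { rewrite Hr. split; [lra|]. split; [assumption|]. intros r Hr'. apply Hbelow. lra. }
  assert (Hu := epsilon_spec (inhabits 0) _ (ex_intro _ t Ht)).
  change (epsilon _ _) with (u (Cantor.to_nat (p, q))) in Hu.
  destruct Ht as (T1 & T2 & T3). destruct Hu as (U1 & U2 & U3).
  destruct (Rtotal_order t (u (Cantor.to_nat (p, q)))) as [Hlt|[Heq|Hgt]]; auto.
  - specialize (U3 t ltac:(lra)). lra.
  - specialize (T3 (u (Cantor.to_nat (p, q))) ltac:(lra)). lra.
Qed.

(** * Derivatives of the reflected path *)

Section Reflection.
Context (c : R) (w w' : R -> R) (B M M' T : R).
Context (HM : 0 < M) (Hw : lipschitz w M) (HB : forall s, w s <= B).
Context (Hw' : lipschitz w' M').
Context (Hd : forall t, 0 < t < T -> derivable_pt_lim w t (w' t)).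

Notation y := (reflect c w).

Lemma reflect_le t : y t <= c.
Proof. unfold reflect. assert (X := overshoot_ge c w B HB t t (Rle_refl t)). lra. Qed.

(** By the Lipschitz bound the path stays below [c] near [t], so the running maximum sets no new
    record and is locally constant. *)
Lemma reflect_derivative_below t : 0 < t < T -> y t < c -> derivable_pt_lim y t (w' t).
Proof.
  intros Ht Hlt. pose (e := c - y t). pose (d := e / (4 * M)).
  assert (He : 0 < e) by (unfold e; lra).
  assert (Hd0 : 0 < d) by (apply Rdiv_lt_0_compat; lra).
  assert (Hnear : forall s, Rabs (s - t) < d -> y s <= c - e / 2).
  { intros s Hs. assert (X := reflect_lipschitz c w B M ltac:(lra) HB Hw s t).
    assert (2 * M * Rabs (s - t) <= 2 * M * d) by (apply Rmult_le_compat_l; lra).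
    assert (2 * M * d = e / 2) by (unfold d; field; lra).
    apply Rabs_le_between in X. unfold e in *. lra. }
  assert (Hconst : forall s s', s <= s' -> Rabs (s - t) < d -> Rabs (s' - t) < d ->
    overshoot c w s' = overshoot c w s).
  { intros s s' Hss Hs Hs'. assert (X := overshoot_mono c w B HB s s' Hss).
    apply Rle_antisym; [|assumption].
    (* Between [s] and [s'] the value [w r - c] stays at least [e / 2] below the final maximum,
       which must therefore already have been reached by [s]. *)
    assert (Y : overshoot c w s' <= Rmax (overshoot c w s) (overshoot c w s' - e / 2)).
    { apply (overshoot_extend c w B HB s s'); [apply Rmax_l|].
      intros r Hr. eapply Rle_trans; [|apply Rmax_r].
      specialize (Hnear r ltac:(Rabs_split; lra)). unfold reflect in Hnear.
      assert (Z := overshoot_mono c w B HB r s' ltac:(lra)). lra. }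
    minmax; lra. }
  intros eps Heps. destruct (Hd t Ht eps Heps) as [del Hdel].
  assert (Hpos : 0 < Rmin del d) by (apply Rmin_glb_lt; [apply cond_pos|assumption]).
  exists (mkposreal _ Hpos). simpl. intros k Hk Hkd.
  assert (Hk' : Rabs k < del /\ Rabs k < d) by (split; (eapply Rlt_le_trans; [exact Hkd|]); [apply Rmin_l|apply Rmin_r]).
  assert (Ho : overshoot c w (t + k) = overshoot c w t).
  { assert (Rabs (t - t) < d) by (rewrite Rminus_diag, Rabs_R0; assumption).
    assert (Rabs (t + k - t) < d) by (replace (t + k - t) with k by ring; tauto).
    destruct (Rle_dec t (t + k)); [|symmetry]; apply Hconst; auto; lra. }
  unfold reflect. rewrite Ho.
  replace (w (t + k) - overshoot c w t - (w t - overshoot c w t)) with (w (t + k) - w t) by ring.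
  apply Hdel; tauto.
Qed.

Lemma reflect_contact t : y t = c -> overshoot c w t = w t - c.
Proof. unfold reflect. lra. Qed.

(** At contact [w] attains its maximum over the past, so left difference quotients are
    nonnegative. *)
Lemma reflect_contact_velocity t : 0 < t < T -> y t = c -> 0 <= w' t.
Proof.
  intros Ht Hyt. apply Rnot_lt_le. intros Hneg.
  destruct (Hd t Ht (- w' t) ltac:(lra)) as [del Hdel]. assert (Hdp := cond_pos del).
  specialize (Hdel (- (del / 2)) ltac:(lra)). rewrite Rabs_left in Hdel by lra.
  specialize (Hdel ltac:(lra)).
  assert (X := overshoot_ge c w B HB (t + - (del / 2)) t ltac:(lra)).
  rewrite (reflect_contact t Hyt) in X.
  assert (0 <= (w (t + - (del / 2)) - w t) / - (del / 2)).
  { replace ((w (t + - (del / 2)) - w t) / - (del / 2)) with ((w t - w (t + - (del / 2))) / (del / 2)) by (field; lra).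
    apply Rdiv_le_0_compat; lra. }
  Rabs_split; lra.
Qed.

(** At contact the running maximum equals [w r - c]. If [w] falls at rate at most [a], that maximum
    can exceed [w q - c] by at most [a * (q - r)]. *)
Lemma reflect_near_contact r q a :
  y r = c -> 0 < r -> r <= q < T -> 0 <= a -> (forall u, r <= u <= q -> - a <= w' u) ->
  c - a * (q - r) <= y q.
Proof.
  intros Hyr Hr Hq Ha Hslope.
  assert (Hinc : forall s, r <= s <= q -> w s <= w q + a * (q - r)).
  { intros s Hs. destruct (Req_EM_T s q) as [->|Hne].
    - assert (0 <= a * (q - r)) by (apply Rmult_le_pos; lra). lra.
    - destruct (MVT_cor2 w w' s q) as [u [Hu1 Hu2]]; [lra|intros; apply Hd; lra|].
      assert (- a * (q - s) <= w' u * (q - s)) by (apply Rmult_le_compat_r; [lra|apply Hslope; lra]).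
      assert (a * (q - s) <= a * (q - r)) by (apply Rmult_le_compat_l; lra). lra. }
  assert (X : overshoot c w q <= w q - c + a * (q - r)).
  { apply (overshoot_extend c w B HB r q).
    - rewrite (reflect_contact r Hyr). specialize (Hinc r ltac:(lra)). lra.
    - intros s Hs. specialize (Hinc s Hs). lra. }
  unfold reflect. lra.
Qed.

(** As the path never exceeds [c], only a lower bound is at stake. To the right it follows from
    [0 <= w' t] and continuity of [w']. To the left, a vanishing [w' t] makes [w] nearly flat while
    the running maximum is monotone; a positive one requires the hypothesis on arrivals. *)
Lemma reflect_derivative_contact t :
  0 < t < T -> y t = c -> ~ arrival c y t -> derivable_pt_lim y t 0.
Proof.
  intros Ht Hyt Harr. assert (Hv := reflect_contact_velocity t Ht Hyt).
  assert (Hcont : forall e, 0 < e -> exists d, 0 < d /\ d < t /\ d < T - t /\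
    forall s, Rabs (s - t) <= d -> Rabs (w' s - w' t) <= e).
  { intros e He. pose (k := Rabs M' + 1). assert (Hk : 0 < k) by (unfold k; assert (X := Rabs_pos M'); lra).
    pose (d := Rmin (e / k) (Rmin (t / 2) ((T - t) / 2))).
    assert (He' : 0 < e / k) by (apply Rdiv_lt_0_compat; lra).
    assert (Hd0 : 0 < d) by (unfold d; repeat apply Rmin_glb_lt; lra).
    assert (Hd1 : d <= e / k /\ d <= t / 2 /\ d <= (T - t) / 2) by (unfold d; clear - He'; minmax; lra).
    exists d. repeat split; try lra. intros s Hs. eapply Rle_trans; [apply Hw'|].
    apply Rle_trans with (k * (e / k)); [|right; field; lra].
    assert (P := Rabs_pos (s - t)).
    apply Rle_trans with (k * Rabs (s - t)).
    - apply Rmult_le_compat_r; [assumption|]. unfold k. assert (Y := Rle_abs M'). lra.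
    - apply Rmult_le_compat_l; lra. }
  intros eps Heps. destruct (Hcont (eps / 2)) as (d1 & Hd1 & Hd1t & Hd1T & Hc1); [lra|].
  assert (Hleft : exists d2, 0 < d2 /\ forall q, t - d2 < q < t -> c - (eps / 2) * (t - q) <= y q).
  { destruct (Req_EM_T (w' t) 0) as [Hz|Hnz].
    - exists d1. split; [assumption|]. intros q Hq.
      destruct (MVT_cor2 w w' q t) as [u [Hu1 Hu2]]; [lra|intros; apply Hd; lra|].
      specialize (Hc1 u ltac:(Rabs_split; lra)). rewrite Hz, Rminus_0_r in Hc1.
      apply Rabs_le_between in Hc1.
      assert (w' u * (t - q) <= eps / 2 * (t - q)) by (apply Rmult_le_compat_r; lra).
      assert (X := overshoot_mono c w B HB q t ltac:(lra)). rewrite (reflect_contact t Hyt) in X.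
      unfold reflect. lra.
    - destruct (Hcont (w' t)) as (d & Hd0 & Hdt & HdT & Hc); [lra|].
      (* Without an arrival at [t] there are earlier contacts arbitrarily close to it. After one in
         the zone where [w'] is nonnegative, the path stays at [c]. *)
      assert (Hr : exists r, t - d <= r < t /\ y r = c).
      { apply NNPP. intros Hno. apply Harr. split; [assumption|]. exists (t - d). split; [lra|].
        intros r Hr. destruct (Rle_lt_or_eq_dec _ _ (reflect_le r)) as [H|H]; [assumption|].
        exfalso. apply Hno. exists r. tauto. }
      destruct Hr as (r & Hr & Hyr). exists (t - r). split; [lra|]. intros q Hq.
      assert (X := reflect_near_contact r q 0 Hyr ltac:(lra) ltac:(lra) (Rle_refl 0)).
      assert (0 <= eps / 2 * (t - q)) by (apply Rmult_le_pos; lra).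
      rewrite Rmult_0_l, Rminus_0_r in X. eapply Rle_trans; [|apply X]; [lra|].
      intros u Hu. specialize (Hc u ltac:(Rabs_split; lra)). apply Rabs_le_between in Hc. lra. }
  destruct Hleft as (d2 & Hd2 & Hleft).
  assert (Hpos : 0 < Rmin d1 d2) by (apply Rmin_glb_lt; assumption).
  exists (mkposreal _ Hpos). simpl. intros k Hk Hkd.
  assert (Hk' : Rabs k < d1 /\ Rabs k < d2) by (split; (eapply Rlt_le_trans; [exact Hkd|]); [apply Rmin_l|apply Rmin_r]).
  assert (Hlow : c - (eps / 2) * Rabs k <= y (t + k)).
  { destruct (Rlt_dec k 0) as [Hneg|Hnneg].
    - rewrite Rabs_left in * by assumption. replace (- k) with (t - (t + k)) by ring. apply Hleft. lra.
    - rewrite Rabs_right in * by lra. replace k with (t + k - t) at 1 by ring.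
      apply reflect_near_contact; auto; try lra.
      intros u Hu. specialize (Hc1 u ltac:(Rabs_split; lra)). apply Rabs_le_between in Hc1. lra. }
  assert (Hup := reflect_le (t + k)).
  rewrite Rminus_0_r, Hyt. unfold Rdiv. rewrite Rabs_mult, Rabs_inv.
  assert (Hka : 0 < Rabs k) by (apply Rabs_pos_lt; assumption).
  apply (Rmult_lt_reg_r (Rabs k)); [assumption|]. rewrite Rmult_assoc, Rinv_l, Rmult_1_r by lra.
  rewrite Rabs_left1 by lra. assert (0 < eps * Rabs k) by (apply Rmult_lt_0_compat; assumption). lra.
Qed.

End Reflection.

(** * Existence *)

Lemma lipschitz2_clamp f x0 y0 r L :
  0 <= r -> 0 <= L -> lipschitz_box f x0 y0 r L ->
  lipschitz2 (fun x y => f (clamp (x0 - r) (x0 + r) x) (clamp (y0 - r) (y0 + r) y)) L.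
Proof.
  intros Hr HL Hf x y x' y'.
  assert (Hc : forall a b, Rabs (clamp (a - r) (a + r) b - a) <= r).
  { intros a b. assert (X := clamp_range (a - r) (a + r) b ltac:(lra)). Rabs_split; lra. }
  eapply Rle_trans; [apply Hf; apply Hc|]. apply Rmult_le_compat_l; [assumption|].
  apply Rplus_le_compat; apply clamp_lipschitz; lra.
Qed.

Lemma clamp_bound f x0 y0 r L x y :
  0 <= r -> 0 <= L -> lipschitz_box f x0 y0 r L ->
  Rabs (f (clamp (x0 - r) (x0 + r) x) (clamp (y0 - r) (y0 + r) y)) <= Rabs (f x0 y0) + L * (2 * r).
Proof.
  intros Hr HL Hf.
  assert (Hc : forall a b, Rabs (clamp (a - r) (a + r) b - a) <= r).
  { intros a b. assert (X := clamp_range (a - r) (a + r) b ltac:(lra)). Rabs_split; lra. }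
  assert (Hz : forall a, Rabs (a - a) <= r) by (intros; rewrite Rminus_diag, Rabs_R0; lra).
  assert (X := Hf _ _ _ _ (Hc x0 x) (Hc y0 y) (Hz x0) (Hz y0)).
  assert (Y := Rmult_le_compat_l L _ _ HL (Rplus_le_compat _ _ _ _ (Hc x0 x) (Hc y0 y))).
  assert (Z := Rabs_triang_inv (f (clamp (x0 - r) (x0 + r) x) (clamp (y0 - r) (y0 + r) y)) (f x0 y0)). lra.
Qed.

(** The fields are clamped to the box to become globally Lipschitz and bounded, and the time is so
    short that the clamps are inactive along the solution. Only Lipschitz continuity is asked, so
    that [h] may be $\pm|H|$. *)
Lemma reflected_ode g h x0 y0 c r L :
  0 < r -> 0 < L -> y0 <= c -> lipschitz_box g x0 y0 r L -> lipschitz_box h x0 y0 r L ->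
  exists T C N x y, 0 < T /\ 0 < C /\ lipschitz x C /\ lipschitz y C /\ x 0 = x0 /\ y 0 = y0 /\
    null1 N /\ forall t, 0 < t < T ->
      Rabs (x t - x0) <= r /\ Rabs (y t - y0) <= r /\ derivable_pt_lim x t (g (x t) (y t)) /\
      (~ N t -> (y t < c /\ derivable_pt_lim y t (h (x t) (y t))) \/
                (y t = c /\ 0 <= h (x t) (y t) /\ derivable_pt_lim y t 0)).
Proof.
  intros Hr HL Hc Hg Hh.
  pose (cl := fun (f : R -> R -> R) x y => f (clamp (x0 - r) (x0 + r) x) (clamp (y0 - r) (y0 + r) y)).
  assert (Lg : lipschitz2 (cl g) L) by (apply lipschitz2_clamp; auto; lra).
  assert (Lh : lipschitz2 (cl h) L) by (apply lipschitz2_clamp; auto; lra).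
  pose (M := Rabs (g x0 y0) + Rabs (h x0 y0) + L * (2 * r) + 1).
  assert (P1 := Rabs_pos (g x0 y0)). assert (P2 := Rabs_pos (h x0 y0)).
  assert (P3 : 0 <= L * (2 * r)) by (apply Rmult_le_pos; lra).
  assert (HM : 0 < M) by (unfold M; lra).
  assert (Bg : forall x y, Rabs (cl g x y) <= M).
  { intros x y. assert (X := clamp_bound g x0 y0 r L x y ltac:(lra) ltac:(lra) Hg). unfold cl, M. lra. }
  assert (Bh : forall x y, Rabs (cl h x y) <= M).
  { intros x y. assert (X := clamp_bound h x0 y0 r L x y ltac:(lra) ltac:(lra) Hh). unfold cl, M. lra. }
  (* The first bound gives contraction; the second keeps the [2 * M]-Lipschitz reflected path within
     [r] of its start. *)
  pose (T := Rmin (/ (6 * L)) (r / (2 * M))).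
  assert (HT : 0 < T).
  { apply Rmin_glb_lt; [apply Rinv_0_lt_compat; lra|apply Rdiv_lt_0_compat; lra]. }
  assert (HLT : 6 * L * T <= 1).
  { apply Rle_trans with (6 * L * / (6 * L)); [apply Rmult_le_compat_l; [lra|apply Rmin_l]|right; field; lra]. }
  assert (HMT : 2 * M * T <= r).
  { apply Rle_trans with (2 * M * (r / (2 * M))); [apply Rmult_le_compat_l; [lra|apply Rmin_r]|right; field; lra]. }
  destruct (picard_fixpoint (cl g) (cl h) x0 y0 c L M T) as [[x w] [Ha Hfix]]; auto; try lra.
  assert (Ag := along_lipschitz y0 c L M T ltac:(lra) ltac:(lra) (cl g) (x, w) Lg Ha).
  assert (Ah := along_lipschitz y0 c L M T ltac:(lra) ltac:(lra) (cl h) (x, w) Lh Ha).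
  destruct Ha as (Lx & Lw & Bw). cbn [fst snd] in Lx, Lw, Bw, Hfix.
  set (y := reflect c w).
  assert (Ly : lipschitz y (2 * M)) by (apply reflect_lipschitz with (y0 + M * T); auto; lra).
  assert (Hx0 : x 0 = x0).
  { rewrite (proj1 (Hfix 0)). apply primitive_past; lra. }
  (* With [w] equal to [y0 <= c] in the past, the running maximum vanishes at time 0 and reflection
     preserves the initial value. *)
  assert (Hwpast : forall s, s <= 0 -> w s = y0).
  { intros s Hs. rewrite (proj2 (Hfix s)). apply primitive_past; lra. }
  assert (Hy0 : y 0 = y0).
  { unfold y, reflect. rewrite Hwpast by lra.
    assert (overshoot c w 0 = 0); [|lra]. apply Rle_antisym.
    - apply (overshoot_le c w _ Bw); [lra|]. intros s Hs. rewrite Hwpast by assumption. lra.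
    - apply (overshoot_ge0 c w _ Bw). }
  assert (Hnear : forall t, 0 < t < T -> Rabs (x t - x0) <= r /\ Rabs (y t - y0) <= r).
  { intros t Ht. assert (X := Lx t 0). assert (Y := Ly t 0).
    rewrite Hx0 in X. rewrite Hy0 in Y. rewrite Rminus_0_r, (Rabs_right t) in X, Y by lra.
    assert (2 * M * t <= 2 * M * T) by (apply Rmult_le_compat_l; lra).
    assert (0 <= M * t) by (apply Rmult_le_pos; lra). lra. }
  assert (Hcl : forall f t, 0 < t < T -> along c (cl f) (x, w) t = f (x t) (y t)).
  { intros f t Ht. unfold along, cl. cbn [fst snd]. fold y. destruct (Hnear t Ht) as [X Y].
    apply Rabs_le_between in X. apply Rabs_le_between in Y. rewrite !clamp_id by lra. reflexivity. }
  assert (Dx : forall t, 0 < t < T -> derivable_pt_lim x t (g (x t) (y t))).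
  { intros t Ht. rewrite <- (Hcl g t Ht).
    apply derivable_pt_lim_ext with (primitive T x0 (along c (cl g) (x, w))).
    - intros s. symmetry. apply (Hfix s).
    - apply primitive_derivative with (L * (3 * M)); assumption. }
  assert (Dw : forall t, 0 < t < T -> derivable_pt_lim w t (along c (cl h) (x, w) t)).
  { intros t Ht.
    apply derivable_pt_lim_ext with (primitive T y0 (along c (cl h) (x, w))).
    - intros s. symmetry. apply (Hfix s).
    - apply primitive_derivative with (L * (3 * M)); assumption. }
  exists T, (2 * M), (arrival c y), x, y.
  split; [assumption|]. split; [lra|]. split.
  { intros s t. eapply Rle_trans; [apply Lx|]. apply Rmult_le_compat_r; [apply Rabs_pos|lra]. }
  split; [assumption|]. split; [assumption|]. split; [assumption|]. split; [apply arrival_null|].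
  intros t Ht. destruct (Hnear t Ht) as [X Y]. split; [assumption|]. split; [assumption|].
  split; [apply Dx, Ht|]. intros HN. rewrite <- (Hcl h t Ht).
  destruct (Rle_lt_or_eq_dec _ _ (reflect_le c w _ Bw t)) as [Hlt|Heq]; [left|right].
  - split; [assumption|]. apply (reflect_derivative_below c w _ _ M T HM Lw Bw Dw); assumption.
  - split; [assumption|]. split.
    + apply (reflect_contact_velocity c w _ _ T Bw Dw); assumption.
    + apply (reflect_derivative_contact c w _ _ _ T Bw Ah Dw); assumption.
Qed.

(** The mirror image $y \mapsto -y$ turns a lower barrier into an upper one, with the sign of the
    vertical field reversed. *)
Lemma reflected_ode_lower g h x0 y0 c r L :
  0 < r -> 0 < L -> c <= y0 -> lipschitz_box g x0 y0 r L -> lipschitz_box h x0 y0 r L ->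
  exists T C N x y, 0 < T /\ 0 < C /\ lipschitz x C /\ lipschitz y C /\ x 0 = x0 /\ y 0 = y0 /\
    null1 N /\ forall t, 0 < t < T ->
      Rabs (x t - x0) <= r /\ Rabs (y t - y0) <= r /\ derivable_pt_lim x t (g (x t) (y t)) /\
      (~ N t -> (c < y t /\ derivable_pt_lim y t (h (x t) (y t))) \/
                (y t = c /\ h (x t) (y t) <= 0 /\ derivable_pt_lim y t 0)).
Proof.
  intros Hr HL Hc Hg Hh.
  assert (Hm : forall f, lipschitz_box f x0 y0 r L -> lipschitz_box (fun a b => f a (- b)) x0 (- y0) r L).
  { intros f Hf a b a' b' H1 H2 H3 H4.
    replace (Rabs (b - b')) with (Rabs (- b - - b')) by (Rabs_split; lra).
    apply Hf; auto; Rabs_split; lra. }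
  destruct (reflected_ode (fun a b => g a (- b)) (fun a b => - h a (- b)) x0 (- y0) (- c) r L)
    as (T & C & N & x & y & HT & HC & Lx & Ly & Hx0 & Hy0 & HN & Hsol); auto; try lra.
  { apply lipschitz_box_opp, Hm, Hh. }
  exists T, C, N, x, (fun t => - y t). repeat (split; [assumption|]).
  split; [|split; [assumption|split; [lra|split; [assumption|]]]].
  - intros s t. replace (- y s - - y t) with (- (y s - y t)) by ring. rewrite Rabs_Ropp. apply Ly.
  - intros t Ht. destruct (Hsol t Ht) as (X & Y & Dx & D).
    split; [assumption|]. split; [Rabs_split; lra|]. split; [assumption|].
    intros HNt. destruct (D HNt) as [[D1 D2]|(D1 & D2 & D3)]; [left|right].
    + split; [lra|]. rewrite <- (Ropp_involutive (h (x t) (- y t))). apply derivable_pt_lim_opp, D2.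
    + split; [lra|]. split; [lra|]. rewrite <- Ropp_0. apply derivable_pt_lim_opp, D3.
Qed.

Lemma filippov_sol_lipschitz F T C N x y :
  0 < T -> 0 < C -> lipschitz x C -> lipschitz y C -> null1 N ->
  (forall t, 0 < t < T -> ~ N t -> exists a b,
     derivable_pt_lim x t a /\ derivable_pt_lim y t b /\ filippov_K F (x t, y t) (a, b)) ->
  filippov_sol F T (fun t => (x t, y t)).
Proof.
  intros HT HC Lx Ly HN H. split; [assumption|]. split.
  - split; apply lipschitz_abs_cont1 with C; assumption.
  - exists N. split; [assumption|]. intros t Ht HNt.
    destruct (H t Ht HNt) as (a & b & Da & Db & K). exists (a, b). auto.
Qed.

(** Only a local solution is sought, so the box is shrunk until at most one edge matters. *)
Lemma Fsys_exists G H z0 :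
  C1_2 G -> C1_2 H -> exists T z, filippov_sol (Fsys G H) T z /\ z 0 = z0.
Proof.
  intros hG hH. destruct z0 as [x0 y0].
  destruct (C1_lipschitz_box2 G H x0 y0 hG hH) as (r0 & L & Hr0 & HL & LG0 & LH0).
  assert (Hshrink : forall d, 0 < d -> exists r, 0 < r /\ r <= d /\
    lipschitz_box G x0 y0 r L /\ lipschitz_box H x0 y0 r L).
  { intros d Hd. exists (Rmin r0 d). split; [apply Rmin_glb_lt; assumption|]. split; [apply Rmin_r|].
    split; apply lipschitz_box_le with r0 L; auto; try lra; apply Rmin_l. }
  destruct (Rlt_dec 1 y0) as [Habove|Hnabove];
    [|destruct (Rlt_dec 0 y0) as [Hin|Hnin]; [|destruct (Req_EM_T y0 0) as [Hzero|Hnzero]]].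
  - destruct (Hshrink (Rmin (/ 2) ((y0 - 1) / 2))) as (r & Hr & Hrd & LG & LH); [apply Rmin_glb_lt; lra|].
    assert (Hrd' : r <= / 2 /\ r <= (y0 - 1) / 2) by (minmax; lra).
    (* The barrier [y0 + 1] is out of reach because [r <= / 2]; the reflected problem is then an
       ordinary equation. *)
    destruct (reflected_ode G (fun a b => - Rabs (H a b)) x0 y0 (y0 + 1) r L)
      as (T & C & N & x & y & HT & HC & Lx & Ly & Hx0 & Hy0 & HN & Hsol); auto; try lra.
    { apply lipschitz_box_opp, lipschitz_box_abs, LH. }
    exists T, (fun t => (x t, y t)). split; [|rewrite Hx0, Hy0; reflexivity].
    apply filippov_sol_lipschitz with C N; auto. intros t Ht HNt.
    destruct (Hsol t Ht) as (X & Y & Dx & D). apply Rabs_le_between in Y.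
    destruct (D HNt) as [[D1 D2]|[D1 _]]; [|lra].
    exists (G (x t) (y t)), (- Rabs (H (x t) (y t))). split; [assumption|]. split; [assumption|].
    apply filippov_K_robust, robust_above_strip; auto; lra.
  (* Interior points and the upper edge are treated together: the barrier is 1, and [r <= y0 / 2]
     keeps the path away from 0. *)
  - destruct (Hshrink (y0 / 2)) as (r & Hr & Hrd & LG & LH); [lra|].
    destruct (reflected_ode G H x0 y0 1 r L)
      as (T & C & N & x & y & HT & HC & Lx & Ly & Hx0 & Hy0 & HN & Hsol); auto; try lra.
    exists T, (fun t => (x t, y t)). split; [|rewrite Hx0, Hy0; reflexivity].
    apply filippov_sol_lipschitz with C N; auto. intros t Ht HNt.
    destruct (Hsol t Ht) as (X & Y & Dx & D). apply Rabs_le_between in Y.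
    destruct (D HNt) as [[D1 D2]|(D1 & D2 & D3)].
    + exists (G (x t) (y t)), (H (x t) (y t)). split; [assumption|]. split; [assumption|].
      apply filippov_K_robust, robust_strip_below; auto; lra.
    + exists (G (x t) (y t)), 0. split; [assumption|]. split; [assumption|].
      rewrite D1 in *. apply Fsys_slide_top; assumption.
  - subst y0. destruct (Hshrink (/ 2)) as (r & Hr & Hrd & LG & LH); [lra|].
    destruct (reflected_ode_lower G H x0 0 0 r L)
      as (T & C & N & x & y & HT & HC & Lx & Ly & Hx0 & Hy0 & HN & Hsol); auto; try lra.
    exists T, (fun t => (x t, y t)). split; [|rewrite Hx0, Hy0; reflexivity].
    apply filippov_sol_lipschitz with C N; auto. intros t Ht HNt.
    destruct (Hsol t Ht) as (X & Y & Dx & D). apply Rabs_le_between in Y.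
    destruct (D HNt) as [[D1 D2]|(D1 & D2 & D3)].
    + exists (G (x t) (y t)), (H (x t) (y t)). split; [assumption|]. split; [assumption|].
      apply filippov_K_robust, robust_strip_above; auto; lra.
    + exists (G (x t) (y t)), 0. split; [assumption|]. split; [assumption|].
      rewrite D1 in *. apply Fsys_slide_bottom; assumption.
  - destruct (Hshrink (Rmin (/ 2) (- y0 / 2))) as (r & Hr & Hrd & LG & LH); [apply Rmin_glb_lt; lra|].
    assert (Hrd' : r <= / 2 /\ r <= - y0 / 2) by (minmax; lra).
    destruct (reflected_ode G (fun a b => Rabs (H a b)) x0 y0 (y0 + 1) r L)
      as (T & C & N & x & y & HT & HC & Lx & Ly & Hx0 & Hy0 & HN & Hsol); auto; try lra.
    { apply lipschitz_box_abs, LH. }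
    exists T, (fun t => (x t, y t)). split; [|rewrite Hx0, Hy0; reflexivity].
    apply filippov_sol_lipschitz with C N; auto. intros t Ht HNt.
    destruct (Hsol t Ht) as (X & Y & Dx & D). apply Rabs_le_between in Y.
    destruct (D HNt) as [[D1 D2]|[D1 _]]; [|lra].
    exists (G (x t) (y t)), (Rabs (H (x t) (y t))). split; [assumption|]. split; [assumption|].
    apply filippov_K_robust, robust_below_strip; auto; lra.
Qed.

Theorem theorem3p1 (G H : R -> R -> R) (hG : C1_2 G) (hH : C1_2 H) :
  (* existence of a (local, forward) Filippov solution for every initial value *)
  (forall z0 : pt, exists T (z : R -> pt),
      filippov_sol (Fsys G H) T z /\ z 0 = z0) /\
  (* uniqueness in forward time *)
  (forall (T1 T2 : R) (z1 z2 : R -> pt),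
      filippov_sol (Fsys G H) T1 z1 -> filippov_sol (Fsys G H) T2 z2 ->
      z1 0 = z2 0 ->
      forall t, 0 <= t -> t <= T1 -> t <= T2 -> z1 t = z2 t) /\
  (* forward invariance of the strip R x [0,1] *)
  (forall (T : R) (z : R -> pt),
      filippov_sol (Fsys G H) T z -> 0 <= snd (z 0) <= 1 ->
      forall t, 0 <= t <= T -> 0 <= snd (z t) <= 1).
Proof.
  split; [|split].
  - intros z0. apply Fsys_exists; assumption.
  - intros T1 T2 z1 z2 S1 S2 H0 t Ht Ht1 Ht2. apply (Fsys_unique G H T1 T2); assumption.
  - intros T z S H0 t Ht. apply (Fsys_strip_invariant G H T); assumption.
Qed.
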